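(* Let $m<n$ and $L\ge 1$ be integers, and let $A\in\mathbb{R}^{m\times n}$ have i.i.d. $\mathcal{N}(0,1)$ entries. Let $0<x_{\min}\le x_{\max}$ and let $\boldsymbol{x}_o\in\mathbb{R}^n$ satisfy $x_{\min}\le x_{o,i}\le x_{\max}$ for all $i$. For $\ell=1,\dots,L$ observe $\boldsymbol{y}_\ell = A X_o \boldsymbol{w}_\ell$, where $X_o=\mathrm{diag}(\boldsymbol{x}_o)$ and $\boldsymbol{w}_1,\dots,\boldsymbol{w}_L$ are i.i.d. $\mathcal{N}(\mathbf 0,\sigma_w^2 I_n)$, independent of $A$. Fix a vector $\boldsymbol{u}$ and a map $\boldsymbol\theta\mapsto g_{\boldsymbol\theta}(\boldsymbol u)\in\mathbb{R}^n$ which, as a function of $\boldsymbol\theta\in B_k\big(\mathbf 0, x_{\max}\sqrt{n/k}\big)=\{\boldsymbol\theta\in\mathbb{R}^k:\|\boldsymbol\theta\|_2\le x_{\max}\sqrt{n/k}\}$, is Lipschitz with Lipschitz constant $1$. Let $\mathcal{C}\subseteq\{g_{\boldsymbol\theta}(\boldsymbol u):\boldsymbol\theta\in B_k(\mathbf 0,x_{\max}\sqrt{n/k})\}$ be a set with $\boldsymbol{x}_o\in\mathcal{C}$ and such that every $\boldsymbol x\in\mathcal C$ satisfies $x_{\min}\le x_i\le x_{\max}$ for all $i$. Let $$\hat{\boldsymbol x}\in\arg\min_{\boldsymbol x\in\mathcal C} f(\boldsymbol x),\qquad f(\boldsymbol x)=\log\det\big(\sigma_w^2 A X^2 A^{\top}\big)+\frac1L\sum_{\ell=1}^L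 \boldsymbol y_\ell^{\top}\big(\sigma_w^2 A X^2A^{\top}\big)^{-1}\boldsymbol y_\ell,\quad X=\mathrm{diag}(\boldsymbol x).$$ Then there exist constants $C_1,C_2,C_3>0$ such that $$\frac1n\|\hat{\boldsymbol x}-\boldsymbol x_o\|_2^2\le C_1\Big(\frac{n}{m^2}\cdot\frac{k\log n}{L}+\frac{\sqrt{k\log n}}{m}\Big)$$ with probability at least $1-C_2\big(e^{-m/2}+e^{-Ln/8}+e^{-C_3k\log n}+e^{k\log n-n/2}\big)$.
   Context: This is the maximum-likelihood estimator for the real-valued multilook speckle model with no additive noise ($\sigma_z=0$): $f$ is (up to constants) the negative log-likelihood of $\boldsymbol y_1,\dots,\boldsymbol y_L$ given $\boldsymbol x$. The probability is over both $A$ and the speckle vectors $\boldsymbol w_\ell$. *)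

(* Defs.v *)
From HB Require Import structures.
From mathcomp Require Import all_boot all_order all_algebra.
From mathcomp Require Import all_classical all_reals all_analysis.
Set Implicit Arguments. Unset Strict Implicit. Unset Printing Implicit Defensive.
Import Order.TTheory GRing.Theory Num.Theory.
Local Open Scope classical_set_scope.
Local Open Scope ring_scope.

Definition l2norm {R : realType} {n : nat} (v : 'rV[R]_n) : R :=
  Num.sqrt (\sum_(i < n) v 0 i ^+ 2).

Definition l2ball {R : realType} (k : nat) (r : R) : set 'rV[R]_k :=
  [set th | l2norm th <= r].
Arguments l2ball {R} k r.

(* A finite family of real random variables is mutually independent:
   for every family of Borel sets, the joint probability of the preimages
   factorizes (taking B i = setT recovers every subfamily). *)
Definition mutually_independent {R : realType} {d : measure_display}
  {T : measurableType d} (P : probability T R) (I : finType) (X : I -> T -> R) :=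
  (forall i, measurable_fun setT (X i)) /\
  forall B : I -> set R, (forall i, measurable (B i)) ->
    P (\bigcap_(i in [set: I]) (X i @^-1` B i)) = (\prod_(i : I) P (X i @^-1` B i))%E.

(* X has law N(mu, s^2) (s = standard deviation). *)
Definition has_normal_law {R : realType} {d : measure_display}
  {T : measurableType d} (P : probability T R) (X : T -> R) (mu s : R) :=
  forall B : set R, measurable B -> P (X @^-1` B) = normal_prob mu s B.

Definition speckle_nll {R : realType} {m n L : nat} (sw : R)
  (A : 'M[R]_(m, n)) (y : 'I_L -> 'cV[R]_m) (x : 'rV[R]_n) : R :=
  let X := diag_mx x in
  let S := sw ^+ 2 *: (A *m (X *m X) *m A^T) in
  ln (\det S) + L%:R^-1 * \sum_(l < L) ((y l)^T *m invmx S *m y l) 0 0.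

(* Main.v *)
Require Import Defs.
From HB Require Import structures.
From mathcomp Require Import all_boot all_order all_algebra.
From mathcomp Require Import all_classical all_reals all_analysis.
From mathcomp Require Import measurable_realfun ring lra zify.
Set Implicit Arguments. Unset Strict Implicit. Unset Printing Implicit Defensive.
Import Order.TTheory GRing.Theory Num.Theory.
Import numFieldNormedType.Exports.
Local Open Scope classical_set_scope.
Local Open Scope ring_scope.

(* The maximum likelihood estimate [xhat] is compared with the points of a net.

   For a fixed competitor [x], exp (-L/4 (f x - f xo)) has conditional expectation
   exp (- Psi x) given [A], where Psi x = L/4 (2 ln det K - ln det Sx - ln det So),
   Sx = A X^2 A^T, So = A Xo^2 A^T, K = (Sx + So) / 2 (a Bhattacharyya coefficient),
   and Psi x >= L/4 |A D A^T|_F^2 / |K|^2 for D = (Xo^2 - X^2) / 2.  So, except with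
   probability e^-t, f x <= f xo + s forces |A D A^T|_F^2 <= |K|^2 (4 t / L + s).

   Conversely |A D A^T|_F^2 is at least sum_{p >= m/2 > q} (r_q^T D r_p)^2 over the rows
   r_p of A, a positive semidefinite quadratic form in the rows p >= m/2 given the
   others.  Such forms have a subgaussian lower tail, which yields
   |A D A^T|_F^2 >= m^2 |D|^2 / 6 - C m n sqrt t on the event |A|^2 <= 120 n.

   All three Chernoff bounds come from one Gaussian integral,
   E exp (- w^T (S - 1) w / 2) = (det S)^(-1/2), computed coordinate by coordinate through
   a Cholesky factor of [S], with t of order k ln n to pay for the net. *)

(** * Positive definite matrices *)

Section Dot.
Variable R : realType.

(** The entries of $A D A^\top$ are already quadratic in $A$, so its squared Frobenius norm has
    degree four and has no exponential moment given by a Gaussian integral. Keeping only products of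
    an early row with a late row leaves a form that is quadratic in each half separately, so that
    two Gaussian integrals in succession suffice. As only lower tails are needed, $\ln\det(1+Q)\ge
    \mathrm{tr}\,Q-\mathrm{tr}\,Q^2$ replaces any spectral decomposition.

    No measurability is known of the minimiser, so the bad events that depend on a candidate are
    attached to net points, and a minimiser enters only through $f(\hat x)\le f(x_o)$. The net lies
    inside the constraint set, which keeps its entries in $[x_{\min},x_{\max}]$; its mesh
    $x_{\min}/n^2$ lets the loss move by $O(1/n)$ only.

    Conditioning is never a conditional expectation: on the space of families indexed by all scalar
    entries, a block of coordinates can be redrawn without changing an integral, and whatever does
    not read the block is a constant of the inner integral. *)

Definition dot n (u v : 'cV[R]_n) : R := (u^T *m v) 0 0.

Lemma dotE n (u v : 'cV[R]_n) : dot u v = \sum_i u i 0 * v i 0.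
Proof. by rewrite /dot mxE; apply: eq_bigr => i _; rewrite mxE. Qed.

Lemma dotC n (u v : 'cV[R]_n) : dot u v = dot v u.
Proof. by rewrite !dotE; apply: eq_bigr => i _; rewrite mulrC. Qed.

Lemma dotDl n (u v w : 'cV[R]_n) : dot (u + v) w = dot u w + dot v w.
Proof. by rewrite /dot linearD /= mulmxDl mxE. Qed.

Lemma dotZl n a (u w : 'cV[R]_n) : dot (a *: u) w = a * dot u w.
Proof. by rewrite /dot linearZ /= -scalemxAl mxE. Qed.

Lemma dotNl n (u w : 'cV[R]_n) : dot (- u) w = - dot u w.
Proof. by rewrite -scaleN1r dotZl mulN1r. Qed.

Lemma dotBl n (u v w : 'cV[R]_n) : dot (u - v) w = dot u w - dot v w.
Proof. by rewrite dotDl dotNl. Qed.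

Lemma dotDr n (u v w : 'cV[R]_n) : dot w (u + v) = dot w u + dot w v.
Proof. by rewrite dotC dotDl !(dotC w). Qed.

Lemma dotZr n a (u w : 'cV[R]_n) : dot w (a *: u) = a * dot w u.
Proof. by rewrite dotC dotZl dotC. Qed.

Lemma dotNr n (u w : 'cV[R]_n) : dot w (- u) = - dot w u.
Proof. by rewrite dotC dotNl dotC. Qed.

Lemma dotBr n (u v w : 'cV[R]_n) : dot w (u - v) = dot w u - dot w v.
Proof. by rewrite dotDr dotNr. Qed.

Lemma dot0r n (u : 'cV[R]_n) : dot u 0 = 0.
Proof. by rewrite /dot mulmx0 mxE. Qed.

Lemma dot_mull m n (A : 'M[R]_(m, n)) u v : dot (A *m u) v = dot u (A^T *m v).
Proof. by rewrite /dot trmx_mul mulmxA. Qed.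

Lemma dot_mulr m n (A : 'M[R]_(m, n)) u v : dot u (A *m v) = dot (A^T *m u) v.
Proof. by rewrite dot_mull trmxK. Qed.

Lemma dot_ge0 n (u : 'cV[R]_n) : 0 <= dot u u.
Proof. by rewrite dotE sumr_ge0 // => i _; rewrite -expr2 sqr_ge0. Qed.

Lemma dot_gt0 n (u : 'cV[R]_n) : u != 0 -> 0 < dot u u.
Proof.
move=> u0; rewrite lt0r dot_ge0 andbT; apply: contra u0 => /eqP uu.
apply/eqP/colP => i; rewrite mxE.
move: uu; rewrite dotE => /psumr_eq0P H.
apply/eqP; rewrite -[_ == 0]orbb -mulf_eq0; apply/eqP/H => // j _.
by rewrite -expr2 sqr_ge0.
Qed.

Lemma CauchySchwarz n (u v : 'cV[R]_n) : dot u v ^+ 2 <= dot u u * dot v v.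
Proof.
have [->|v0] := eqVneq v 0; first by rewrite !dot0r mulr0 expr0n.
have vv := dot_gt0 v0; set a := dot u v.
have := dot_ge0 (dot v v *: u - a *: v).
rewrite dotBl !dotBr !dotZl !dotZr (dotC v u) -/a.
have -> : dot v v * (dot v v * dot u u) - dot v v * (a * a) -
  (a * (dot v v * a) - a * (a * dot v v)) = dot v v * (dot u u * dot v v - a ^+ 2) by ring.
by rewrite pmulr_rge0 // subr_ge0.
Qed.

Lemma dot_tr m n (A : 'M[R]_(m, n)) : \tr (A^T *m A) = \sum_j dot (col j A) (col j A).
Proof.
rewrite /mxtrace; apply: eq_bigr => j _; rewrite dotE mxE.
by apply: eq_bigr => i _; rewrite !mxE.
Qed.

Lemma tr_frob m n (A : 'M[R]_(m, n)) : \tr (A^T *m A) = \sum_i \sum_j A i j ^+ 2.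
Proof.
rewrite exchange_big /= dot_tr; apply: eq_bigr => j _; rewrite dotE.
by apply: eq_bigr => i _; rewrite !mxE -expr2.
Qed.

Lemma dot_col_mx m n (u u' : 'cV[R]_m) (v v' : 'cV_n) :
  dot (col_mx u v) (col_mx u' v') = dot u u' + dot v v'.
Proof. by rewrite /dot tr_col_mx mul_row_col mxE. Qed.

(** For $w=A^\top v$, Cauchy-Schwarz gives $|w|^4=\langle Aw,v\rangle^2\le k|w|^2|v|^2$, and one
    factor $|w|^2$ cancels. *)
Lemma opnorm_tr m n (A : 'M[R]_(m, n)) k : 0 <= k ->
  (forall u, dot (A *m u) (A *m u) <= k * dot u u) ->
  forall v, dot (A^T *m v) (A^T *m v) <= k * dot v v.
Proof.
move=> k0 H v; set w := A^T *m v.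
have [->|/dot_gt0 w0] := eqVneq w 0.
  by rewrite !dot0r mulr_ge0 ?dot_ge0.
have : dot (A *m w) v ^+ 2 <= (k * dot w w) * dot v v.
  by rewrite (le_trans (CauchySchwarz _ _)) // ler_wpM2r ?dot_ge0.
rewrite dot_mull -/w.
by rewrite expr2 mulrAC ler_pM2r.
Qed.

End Dot.

Section PosDef.
Variable R : realType.

Definition posdef n (S : 'M[R]_n) :=
  S^T = S /\ forall u : 'cV[R]_n, u != 0 -> 0 < dot u (S *m u).

Lemma posdef_ge0 n (S : 'M[R]_n) u : posdef S -> 0 <= dot u (S *m u).
Proof.
by move=> [_ S0]; have [->|/S0/ltW//] := eqVneq u 0; rewrite mulmx0 dot0r.
Qed.

Lemma posdef_unit n (S : 'M[R]_n) : posdef S -> S \in unitmx.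
Proof.
move=> [sS S0]; rewrite unitmxE unitfE; apply/negP => /det0P[v v0 vS].
have /S0 : v^T != 0 by apply: contra v0 => /eqP/(congr1 trmx); rewrite trmxK trmx0 => ->.
by rewrite -sS -trmx_mul vS trmx0 dot0r ltxx.
Qed.

Lemma posdefD n (S T : 'M[R]_n) : posdef S -> posdef T -> posdef (S + T).
Proof.
move=> [sS S0] [sT T0]; split=> [|u u0]; first by rewrite linearD /= sS sT.
by rewrite mulmxDl dotDr addr_gt0 ?S0 ?T0.
Qed.

Lemma posdefZ n a (S : 'M[R]_n) : 0 < a -> posdef S -> posdef (a *: S).
Proof.
move=> a0 [sS S0]; split=> [|u u0]; first by rewrite linearZ /= sS.
by rewrite -scalemxAl dotZr mulr_gt0 ?S0.
Qed.

Lemma posdef_congr n (S B : 'M[R]_n) :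
  posdef S -> B \in unitmx -> posdef (B^T *m S *m B).
Proof.
move=> [sS S0] uB; split=> [|u u0]; first by rewrite !trmx_mul trmxK sS mulmxA.
rewrite -!mulmxA dot_mulr trmxK S0 //; apply: contra u0 => /eqP Bu.
by rewrite -(mulKmx uB u) Bu mulmx0.
Qed.

Lemma posdef_inv n (S : 'M[R]_n) : posdef S -> posdef (invmx S).
Proof.
move=> pS; have uS := posdef_unit pS; have [sS _] := pS.
have -> : invmx S = (invmx S)^T *m S *m invmx S.
  by rewrite trmx_inv sS mulVmx ?mul1mx.
by apply: posdef_congr; rewrite ?unitmx_inv.
Qed.

Lemma cholesky n (S : 'M[R]_n) : posdef S ->
  exists T : 'M[R]_n, [/\ is_trig_mx T, forall i, 0 < T i i & S = T *m T^T].
Proof.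
elim: n S => [|n IH]; move=> S pS.
  exists 0; split; [exact: mx0_is_trig|by case|by apply/matrixP => -[]].
rewrite -[n.+1]/(1 + n)%N in S pS *.
have [sS S0] := pS.
set a := S 0 0; pose b := dlsubmx S; pose C := drsubmx S.
have eb : ursubmx S = b^T by rewrite /b trmx_dlsub; congr ursubmx.
have ea : ulsubmx S = a%:M.
  by apply/matrixP => i j; rewrite !ord1 !mxE eqxx mulr1n; congr (S _ _); apply: val_inj.
have sC : C^T = C by rewrite /C trmx_drsub; congr drsubmx.
have ES : S = block_mx a%:M b^T b C by rewrite -ea -eb submxK.
clearbody a b C.
have qf x (u : 'cV_n) : dot (col_mx x%:M u : 'cV[R]_(1 + n)) (S *m col_mx x%:M u) =
    a * x ^+ 2 + 2 * x * dot b u + dot u (C *m u).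
  rewrite ES mul_block_col dot_col_mx mul_scalar_mx mul_mx_scalar !dotDr !dotZr.
  rewrite (dotC u b).
  have -> : dot x%:M (x%:M : 'cV[R]_1) = x ^+ 2.
    by rewrite dotE big_ord1 mxE eqxx mulr1n.
  have -> : dot x%:M (b^T *m u) = x * dot b u.
    by rewrite dotE big_ord1 mxE eqxx mulr1n.
  by ring.
have a0 : 0 < a.
  have := S0 (col_mx 1%:M 0 : 'cV[R]_(1 + n)); rewrite qf mulmx0 !dot0r expr1n mulr1 mulr0 !addr0.
  by apply; rewrite col_mx_eq0 negb_and oner_eq0.
have [T [Ttrig T0 ET]] : exists T : 'M[R]_n, [/\ is_trig_mx T, forall i, 0 < T i i &
    C - a^-1 *: (b *m b^T) = T *m T^T].
  apply: IH; split; first by rewrite linearB linearZ /= trmx_mul trmxK sC.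
  (* This first coordinate minimises the form for the given [u]; the minimum is the value at [u] of
     the Schur complement, which is therefore positive. *)
  move=> u u0; have := S0 (col_mx (- (a^-1 * dot b u))%:M u : 'cV[R]_(1 + n)).
  rewrite col_mx_eq0 negb_and u0 orbT qf => /(_ isT).
  rewrite mulmxBl dotBr -scalemxAl dotZr -(mulmxA b) (dot_mulr b).
  have -> : dot (b^T *m u) (b^T *m u) = dot b u ^+ 2.
    by rewrite dotE big_ord1 -/(dot b u) expr2.
  congr (_ < _); field; exact: lt0r_neq0.
pose s := Num.sqrt a.
have s0 : 0 < s by rewrite sqrtr_gt0.
have ss : s * s = a by rewrite -expr2 sqr_sqrtr ?ltW.
exists (block_mx s%:M 0 (s^-1 *: b) T : 'M[R]_(1 + n)); split.
- by rewrite is_trig_block_mx // eqxx Ttrig andbT /=; apply/is_trig_mxP => i j; rewrite !ord1.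
- move=> i; case: (splitP (i : 'I_(1 + n))) => j ej.
    have -> : i = lshift n j by apply: val_inj.
    by rewrite block_mxEul ord1 mxE eqxx.
  have -> : i = rshift 1 j by apply: val_inj.
  by rewrite block_mxEdr.
- rewrite ES tr_block_mx mulmx_block !trmx0 !mul0mx !mulmx0 !addr0 !tr_scalar_mx.
  rewrite -scalar_mxM ss !mul_scalar_mx linearZ /= scalerA mulfV ?gt_eqF // scale1r.
  rewrite mul_mx_scalar scalerA mulfV ?gt_eqF // scale1r -ET; congr block_mx.
  rewrite -scalemxAl -scalemxAr scalerA -invfM ss addrC subrK.
  by [].
Qed.

Lemma posdef_detE n (S T : 'M[R]_n) : is_trig_mx T -> (forall i, 0 < T i i) ->
  S = T *m T^T -> \det S = (\prod_i T i i) ^+ 2 /\ 0 < \prod_i T i i.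
Proof.
move=> tT T0 ->; rewrite det_mulmx det_tr det_trig // expr2; split=> //.
by apply: prodr_gt0 => i _.
Qed.

Lemma posdef_det_gt0 n (S : 'M[R]_n) : posdef S -> 0 < \det S.
Proof.
move=> /cholesky[T [tT T0 /posdef_detE[]// -> ?]]; exact: exprn_gt0.
Qed.

(* Hadamard's inequality followed by [x <= exp (x - 1)] on the diagonal. *)
Lemma posdef_det_le n (S : 'M[R]_n) : posdef S -> \det S <= expR (\tr S - n%:R).
Proof.
move=> /cholesky[T [tT T0 ES]]; have [-> _] := posdef_detE tT T0 ES.
rewrite -prodrXl.
apply: (@le_trans _ _ (\prod_i expR (S i i - 1))).
  apply: ler_prod => i _; rewrite sqr_ge0 /=.
  apply: (@le_trans _ _ (S i i)); last first.
    by have := expR_ge1Dx (S i i - 1); rewrite addrC subrK.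
  rewrite ES mxE (bigD1 i) //= mxE -expr2 lerDl sumr_ge0 // => j _.
  by rewrite mxE -expr2 sqr_ge0.
rewrite -expR_sum ler_expR sumrB /mxtrace sumr_const card_ord.
by [].
Qed.

Lemma posdef_gram n (S : 'M[R]_n) : posdef S ->
  exists T : 'M[R]_n, T \in unitmx /\ S = T *m T^T.
Proof.
move=> /cholesky[T [tT T0 ES]]; exists T; split=> //.
by rewrite unitmxE det_trig // unitfE gt_eqF // prodr_gt0.
Qed.

Lemma posdef1 n : posdef (1%:M : 'M[R]_n).
Proof. by split=> [|u u0]; rewrite ?tr_scalar_mx // mul1mx dot_gt0. Qed.

Lemma le_mxtrace n (S T : 'M[R]_n) :
  (forall u, dot u (S *m u) <= dot u (T *m u)) -> \tr S <= \tr T.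
Proof.
move=> ST; apply: ler_sum => i _; have := ST (delta_mx i 0).
have E (M : 'M[R]_n) : dot (delta_mx i 0) (M *m delta_mx i 0) = M i i.
  by rewrite -colE /dot trmx_delta -rowE !mxE.
by rewrite !E.
Qed.

(** Congruence by the inverse of a factor of [T] reduces to [T = 1]. The trace is then at most [n],
    and [posdef_det_le] bounds the determinant by 1. *)
Lemma le_det n (S T : 'M[R]_n) : posdef S -> posdef T ->
  (forall u, dot u (S *m u) <= dot u (T *m u)) -> \det S <= \det T.
Proof.
move=> pS pT ST; have [B [uB ET]] := posdef_gram pT.
have uBT : invmx B^T \in unitmx by rewrite unitmx_inv unitmx_tr.
have pS' := posdef_congr pS uBT.
have ET1 : (invmx B^T)^T *m T *m invmx B^T = 1%:M.
  by rewrite ET -trmx_inv trmxK !mulmxA mulVmx // mul1mx -trmx_mul mulVmx // trmx1.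
have trS : \tr ((invmx B^T)^T *m S *m invmx B^T) <= n%:R.
  rewrite -(mxtrace1 R n) -ET1; apply: le_mxtrace => u.
  by rewrite -!mulmxA !(dot_mulr (invmx B^T)^T) trmxK ST.
have : \det ((invmx B^T)^T *m S *m invmx B^T) <= 1.
  by apply: (le_trans (posdef_det_le pS')); rewrite -[leRHS]expR0 ler_expR subr_le0.
rewrite !det_mulmx det_tr det_inv det_tr ET det_mulmx det_tr mulrAC -invfM mulrC.
by rewrite ler_pdivrMr ?mul1r // -expr2 exprn_even_gt0 //= -unitfE -unitmxE.
Qed.

(** Completing the square: the gap is the form of [S] at [z - invmx S *m y]. It allows inverses to
    be compared without square roots. *)
Lemma posdef_variational n (S : 'M[R]_n) y z : posdef S ->
  2 * dot z y - dot z (S *m z) <= dot y (invmx S *m y).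
Proof.
move=> pS; have uS := posdef_unit pS; have [sS _] := pS.
have := posdef_ge0 (z - invmx S *m y) pS.
rewrite mulmxBr mulKVmx // !dotBl !dotBr (dot_mulr S (invmx S *m y)) sS mulKVmx //.
rewrite (dotC (invmx S *m y) y) (dotC y z); lra.
Qed.

(** Inversion reverses the order of forms: evaluate the variational bound for [S] at
    $z=c^{-1}T^{-1}y$. *)
Lemma le_dot_invmx n (S T : 'M[R]_n) c y : posdef S -> posdef T -> 0 < c ->
  (forall u, dot u (S *m u) <= c * dot u (T *m u)) ->
  dot y (invmx T *m y) <= c * dot y (invmx S *m y).
Proof.
move=> pS pT c0 ST; set q := dot y _.
have := posdef_variational y (c^-1 *: (invmx T *m y)) pS.
have := ST (c^-1 *: (invmx T *m y)).
rewrite -!scalemxAr !dotZl !dotZr (mulKVmx (posdef_unit pT)) (dotC _ y) -/q.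
have -> : c * (c^-1 * (c^-1 * q)) = c^-1 * q by field; exact: lt0r_neq0.
move=> h1 h2; rewrite -ler_pdivrMl //.
by apply: le_trans h2; lra.
Qed.

(** The left side is $|Pv|^2$ for the orthogonal projection $P=B^\top(BB^\top)^{-1}B$;
    Cauchy-Schwarz is applied to $v$ and $Pv$. *)
Lemma dot_projection m n (B : 'M[R]_(m, n)) v : posdef (B *m B^T) ->
  dot (B *m v) (invmx (B *m B^T) *m (B *m v)) <= dot v v.
Proof.
move=> pS; set S := B *m B^T in pS *; set z := invmx S *m (B *m v).
have q0 : 0 <= dot (B *m v) z by apply: posdef_ge0; exact: posdef_inv.
have E : dot (B^T *m z) (B^T *m z) = dot (B *m v) z.
  by rewrite dot_mull trmxK mulmxA (mulKVmx (posdef_unit pS)) dotC.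
move: q0; rewrite le_eqVlt => /predU1P[<-|q0]; first exact: dot_ge0.
have := CauchySchwarz v (B^T *m z).
by rewrite E (dot_mulr B^T) trmxK expr2 ler_pM2r.
Qed.

(** Sylvester's identity: block elimination in two orders computes the determinant of one block
    matrix. *)
Lemma det_1D_mulC m n (U : 'M[R]_(m, n)) (V : 'M[R]_(n, m)) :
  \det (1%:M + U *m V) = \det (1%:M + V *m U).
Proof.
have <- : \det (block_mx 1%:M (- U) V 1%:M) = \det (1%:M + U *m V).
  have -> : block_mx 1%:M (- U) V 1%:M =
      block_mx (1%:M + U *m V) (- U) 0 1%:M *m block_mx 1%:M 0 V 1%:M.
    by rewrite mulmx_block !mulmx1 !mulmx0 !mul1mx mulNmx addrK !add0r.
  by rewrite det_mulmx det_ublock det_lblock !det1 !mulr1.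
have -> : block_mx 1%:M (- U) V 1%:M =
    block_mx 1%:M 0 V 1%:M *m block_mx 1%:M (- U) 0 (1%:M + V *m U).
  by rewrite mulmx_block !mulmx1 !(mulmx1, mulmx0, mul0mx, mul1mx) mulmxN !(addr0, add0r) [- _ + _]addrC addrK.
by rewrite det_mulmx det_lblock det_ublock !det1 !mul1r.
Qed.

(** With $S=1+Q$, [posdef_det_le] at $S^{-1}$ gives $\ln\det S\ge\mathrm{tr}(1-S^{-1})$, the matrix
    form of $\ln x\ge 1-1/x$. Then $S^{-1}=1-Q+QS^{-1}Q$ and $S^{-1}\le 1$ finish. *)
Lemma ln_det_1D_ge n (Q : 'M[R]_n) : Q^T = Q -> (forall u, 0 <= dot u (Q *m u)) ->
  \tr Q - \tr (Q *m Q) <= ln (\det (1%:M + Q)).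
Proof.
move=> sQ Q0; set S := 1%:M + Q.
have SE u : dot u (S *m u) = dot u u + dot u (Q *m u).
  by rewrite mulmxDl mul1mx dotDr.
have pS : posdef S.
  split=> [|u u0]; first by rewrite linearD /= trmx1 sQ.
  by rewrite SE ltr_pwDl ?dot_gt0.
have uS := posdef_unit pS.
have := posdef_det_le (posdef_inv pS).
rewrite det_inv -[X in X <= _]lnK ?posrE ?invr_gt0 ?posdef_det_gt0 // ler_expR.
rewrite lnV ?posrE ?posdef_det_gt0 // => h.
have EQ : Q = S - 1%:M by rewrite /S addrC addKr.
have E : invmx S = 1%:M - Q + Q *m invmx S *m Q.
  have -> : Q *m invmx S *m Q = S - 1%:M - 1%:M + invmx S.
    rewrite EQ mulmxBl mulmxV // mul1mx mulmxBl mul1mx mulmxBr mulVmx // mulmx1.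
    by rewrite opprB [RHS]addrAC addrA.
  by rewrite EQ; move: (invmx S) (S) => M N; apply/matrixP => i j; rewrite !mxE; ring.
have : \tr (Q *m invmx S *m Q) <= \tr (Q *m Q).
  apply: le_mxtrace => u; rewrite -!mulmxA [leLHS](dot_mulr Q) [leRHS](dot_mulr Q) sQ.
  have := @le_dot_invmx _ 1%:M S 1 (Q *m u) (@posdef1 n) pS ltr01.
  rewrite invmx1 !mul1mx !mul1r; apply => v.
  by rewrite !mul1mx mul1r SE lerDl.
move: h; rewrite [in X in X -> _]E !linearD /= !linearN /= mxtrace1; lra.
Qed.

(** The square of the Frobenius norm, not the norm itself. *)
Definition frob m n (A : 'M[R]_(m, n)) : R := \tr (A^T *m A).

Lemma frob_tr m n (A : 'M[R]_(m, n)) : frob A^T = frob A.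
Proof. by rewrite /frob trmxK mxtrace_mulC. Qed.

Lemma frob_mull m n p (B : 'M[R]_(m, n)) (A : 'M[R]_(n, p)) k :
  (forall u, dot (B *m u) (B *m u) <= k * dot u u) -> frob (B *m A) <= k * frob A.
Proof.
move=> H; rewrite /frob !dot_tr mulr_sumr; apply: ler_sum => j _.
by rewrite !colE -mulmxA; exact: H.
Qed.

(* With K = T T^T and N = T^-1 D T^-T, the left-hand side is at most tr N^2 and
   the right-hand side is - ln det (1 - N^2). *)
Lemma bhattacharyya_ge n (K D : 'M[R]_n) k : 0 < k -> posdef (K - D) -> posdef (K + D) ->
  (forall u, dot u (K *m u) <= k * dot u u) ->
  frob D / k ^+ 2 <= 2 * ln (\det K) - ln (\det (K - D)) - ln (\det (K + D)).
Proof.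
move=> k0 pm pp Kk.
have pK : posdef K.
  have : posdef (2^-1 *: ((K - D) + (K + D))) by apply: posdefZ; [lra|exact: posdefD].
  suff -> : 2^-1 *: ((K - D) + (K + D)) = K by [].
  by apply/matrixP => i j; rewrite !mxE; field.
have sD : D^T = D.
  have [_ /(congr1 (fun M => M - K))] : True /\ (K + D)^T = K + D by split=> //; case: pp.
  by have [sK _] := pK; rewrite linearD /= sK !(addrC K) !addrK.
have [T [uT ET]] := posdef_gram pK.
have uB : invmx T^T \in unitmx by rewrite unitmx_inv unitmx_tr.
pose N := invmx T *m D *m invmx T^T.
have ED : D = T *m N *m T^T.
  by rewrite /N !mulmxA mulmxV // mul1mx -mulmxA mulVmx ?unitmx_tr // mulmx1.
have sN : N^T = N.
  by rewrite /N !trmx_mul sD !trmx_inv trmxK mulmxA.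
have congK : (invmx T^T)^T *m K *m invmx T^T = 1%:M.
  by rewrite ET trmx_inv trmxK !mulmxA mulVmx // mul1mx mulmxV // unitmx_tr.
have congD : (invmx T^T)^T *m D *m invmx T^T = N by rewrite trmx_inv trmxK.
have p1m : posdef (1%:M - N).
  by have := posdef_congr pm uB; rewrite mulmxBr mulmxBl congK congD.
have p1p : posdef (1%:M + N).
  by have := posdef_congr pp uB; rewrite mulmxDr mulmxDl congK congD.
have EM : (1%:M - N) *m (1%:M + N) = 1%:M - N *m N.
  by rewrite mulmxBl !mulmxDr !mul1mx mulmx1 opprD addrA addrK.
(* Twice $1-N^2$ is $(1-N)(1+N)(1-N)+(1+N)(1-N)(1+N)$, a sum of two congruences of positive definite
   matrices. *)
have pNN : posdef (1%:M - N *m N).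
  have := posdefD (posdef_congr p1p (posdef_unit p1m)) (posdef_congr p1m (posdef_unit p1p)).
  case: (p1m) => -> _; case: (p1p) => -> _.
  have -> : (1%:M + N) *m (1%:M - N) = 1%:M - N *m N.
    by rewrite mulmxDl !mulmxBr !mul1mx mulmx1 addrA subrK.
  have EP : (1%:M - N *m N) *m (1%:M + N) + (1%:M - N *m N) *m (1%:M - N) =
      (1%:M - N *m N) + (1%:M - N *m N).
    by rewrite -mulmxDr addrACA subrr addr0 mulmxDr mulmx1.
  rewrite EM addrC in EP *; rewrite EP.
  move=> pN2; have half0 : 0 < 2^-1 :> R by lra.
  have := posdefZ half0 pN2.
  suff -> : 2^-1 *: ((1%:M - N *m N) + (1%:M - N *m N)) = 1%:M - N *m N by [].
  by apply/matrixP => i j; rewrite !mxE; field.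
have := posdef_det_le pNN.
rewrite linearB /= mxtrace1 addrAC subrr add0r -EM det_mulmx.
have d1m := posdef_det_gt0 p1m; have d1p := posdef_det_gt0 p1p.
have dT : 0 < \det T ^+ 2 by rewrite exprn_even_gt0 //= -unitfE -unitmxE.
rewrite -[X in X <= _]lnK ?posrE ?mulr_gt0 // ler_expR lnM ?posrE // => lnN.
have -> : K - D = T *m (1%:M - N) *m T^T.
  by rewrite mulmxBr mulmxBl mulmx1 -ET -ED.
have -> : K + D = T *m (1%:M + N) *m T^T.
  by rewrite mulmxDr mulmxDl mulmx1 -ET -ED.
rewrite [in X in 2 * ln X]ET !det_mulmx !det_tr ![\det T * \det (1%:M + _) * _]mulrAC.
rewrite -!expr2; move: (\det T ^+ 2) dT => a a0; rewrite !lnM ?posrE //.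
have : frob D <= k ^+ 2 * frob N.
  have H1 u : dot (T^T *m u) (T^T *m u) <= k * dot u u.
    by rewrite dot_mull trmxK mulmxA -ET.
  have H2 := opnorm_tr (ltW k0) H1; rewrite trmxK in H2.
  rewrite ED -mulmxA (le_trans (frob_mull _ H2)) // expr2 -mulrA ler_pM2l //.
  by rewrite -frob_tr trmx_mul trmxK -(frob_tr N); exact: frob_mull.
rewrite mulrC -ler_pdivrMr ?exprn_gt0 // => h; apply: (le_trans h).
by rewrite /frob sN; lra.
Qed.

End PosDef.

(** * Resampling coordinates of a product law *)

Section OneDim.
Variable R : realType.
Local Notation mu := (@lebesgue_measure R).
Local Open Scope ereal_scope.

Lemma ge0_integral_normal_prob (m s : R) (f : R -> \bar R) :
  measurable_fun setT f -> (forall x, 0 <= f x) ->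
  \int[normal_prob m s]_x f x = \int[mu]_x (f x * (normal_pdf m s x)%:E).
Proof.
move=> mf f0.
have dom := normal_prob_dominates m s.
rewrite -(Radon_Nikodym_SigmaFinite.change_of_variables dom) //.
have mpdf : measurable_fun setT (fun x => (normal_pdf m s x)%:E).
  by apply/measurable_EFinP; exact: measurable_normal_pdf.
have iRN := Radon_Nikodym_SigmaFinite.f_integrable dom.
apply: ge0_ae_eq_integral => //.
- by apply: emeasurable_funM => //; exact: measurable_int iRN.
- exact: emeasurable_funM.
- by move=> x _; rewrite mule_ge0 //; exact: Radon_Nikodym_SigmaFinite.f_ge0.
- by move=> x _; rewrite mule_ge0 // lee_fin normal_pdf_ge0.
- apply: ae_eqe_mul2l; apply: integral_ae_eq => //.
  by move=> E _ mE; rewrite -Radon_Nikodym_SigmaFinite.f_integral.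
Qed.

(** Multiplied by the density of $N(0,s^2)$, the integrand becomes $r^{-1}$ times the density of
    $N(-bs/r,(s/r)^2)$. *)
Lemma integral_normal_expR (s r b : R) : (0 < s)%R -> (0 < r)%R ->
  \int[normal_prob 0 s]_x
    (expR ((x / s) ^+ 2 / 2 - (r * (x / s) + b) ^+ 2 / 2))%:E = (r^-1)%:E.
Proof.
move=> s0 r0; have sn0 := lt0r_neq0 s0; have rn0 := lt0r_neq0 r0.
rewrite ge0_integral_normal_prob; last 2 first.
- apply/measurable_EFinP; apply: measurableT_comp => //.
  by apply: measurable_funB; apply: measurable_funM => //; apply: measurable_funX;
    repeat (apply: measurable_funD || apply: measurable_funM).
- by move=> x; rewrite lee_fin expR_ge0.
transitivity (\int[mu]_x ((r^-1)%:E * (normal_pdf (- b * s / r) (s / r) x)%:E)).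
  apply: eq_integral => x _; rewrite -!EFinM; congr EFin.
  have srn0 : (s / r != 0)%R by rewrite mulf_neq0 ?invr_neq0.
  rewrite !normal_pdfE // mulrCA -expRD [RHS]mulrA.
  have -> : (r^-1 * normal_peak (s / r) = normal_peak s)%R.
    rewrite /normal_peak -invfM; congr (_^-1)%R.
    have -> : (s ^+ 2 * pi *+ 2 = r ^+ 2 * ((s / r) ^+ 2 * pi *+ 2) :> R)%R.
      by rewrite expr_div_n -!mulrnAr [RHS]mulrA [(r ^+ 2 * _)%R]mulrC divfK // expf_neq0.
    by rewrite sqrtrM ?sqr_ge0 // sqrtr_sqr gtr0_norm.
  congr (_ * expR _)%R; rewrite -mulr_natr.
  by field; rewrite rn0 sn0.
rewrite ge0_integralZl //.
- by rewrite integral_normal_pdf mule1.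
- by apply/measurable_EFinP; exact: measurable_normal_pdf.
- by move=> x _; rewrite lee_fin normal_pdf_ge0.
- by rewrite lee_fin invr_ge0 ltW.
Qed.

End OneDim.

(* [normal_prob] as a measure for the canonical measurable structure of [R]. *)
Definition gauss (R : realType) (s : R) : set R -> \bar R := normal_prob 0 s.

Section Gauss.
Variables (R : realType) (s : R).

HB.instance Definition _ := @isMeasure.Build _ R R (gauss s)
  (@measure0 _ _ _ (normal_prob 0 s)) (@measure_ge0 _ _ _ (normal_prob 0 s))
  (@measure_semi_sigma_additive _ _ _ (normal_prob 0 s)).

HB.instance Definition _ := @Measure_isProbability.Build _ R R (gauss s)
  (@probability_setT _ _ _ (normal_prob 0 s)).

Lemma integral_gauss_expR (r b : R) : (0 < s)%R -> (0 < r)%R ->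
  (\int[gauss s]_x
    (expR ((x / s) ^+ 2 / 2 - (r * (x / s) + b) ^+ 2 / 2))%:E = (r^-1)%:E)%E.
Proof.
move=> s0 r0; rewrite -(integral_normal_expR b s0 r0).
have mid : measurable_fun setT (id : R -> measurableTypeR R) by [].
pose f x : \bar R := (expR ((x / s) ^+ 2 / 2 - (r * (x / s) + b) ^+ 2 / 2))%:E.
have mf : measurable_fun setT (f : measurableTypeR R -> \bar R).
  apply/measurable_EFinP; apply: measurableT_comp => //.
  by apply: measurable_funB; apply: measurable_funM => //; apply: measurable_funX;
    repeat (apply: measurable_funD || apply: measurable_funM).
have f0 : {in setT, forall x, 0 <= f x}%E by move=> x _; rewrite lee_fin expR_ge0.
have := ge0_integral_pushforward mid (gauss s) measurableT mf f0.
rewrite preimage_setT => H; apply: etrans (esym H) _.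
exact: eq_measure_integral.
Qed.

Lemma gauss_set1 (x : R) : s != 0 -> gauss s [set x] = 0%E.
Proof.
move=> s0; have /null_content_dominatesP := normal_prob_dominates 0 s.
by apply => //; exact: lebesgue_measure_set1.
Qed.

End Gauss.

Section ProductSpace.
Variables (R : realType) (I : finType).

(** These are the events of mutual independence and a pi-system; with the sigma-algebra they
    generate, the product formula [muE] determines the law. *)
Definition rectangles : set (set (I -> R)) :=
  [set C | exists2 B : I -> set R, forall i, measurable (B i) &
           C = [set v | forall i, B i (v i)]].

Definition fvec := g_sigma_algebraType rectangles.

Lemma measurable_coord (i : I) : measurable_fun setT (fun v : fvec => v i : R).
Proof.
move=> _ B mB; rewrite setTI; apply: sub_sigma_algebra.
exists (fun j => if j == i then B else setT) => [j|]; first by case: ifP.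
apply/seteqP; split=> v /= => [Bv j|/(_ i)]; last by rewrite eqxx.
by case: eqP => [->|].
Qed.

Lemma measurable_forall_fin d (T : measurableType d) (F : I -> set T) :
  (forall i, measurable (F i)) -> measurable [set t | forall i, F i t].
Proof.
move=> mF; have -> : [set t | forall i, F i t] = \bigcap_(i in [set: I]) F i.
  by apply/seteqP; split=> t /= H i; [move=> _|]; exact: H.
exact: fin_bigcap_measurable.
Qed.

Lemma measurable_to_fvec d (T : measurableType d) (f : T -> fvec) :
  (forall i, measurable_fun setT (fun t => f t i : R)) -> measurable_fun setT f.
Proof.
move=> mf; apply: (@measurability _ _ T fvec setT f rectangles) => //.
move=> _ [_ [B mB ->] <-]; rewrite setTI /preimage /=.
apply: measurable_forall_fin => i; rewrite -[X in measurable X]setTI.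
exact: mf.
Qed.

Lemma rectangles_setI : setI_closed rectangles.
Proof.
move=> _ _ [B mB ->] [C mC ->]; exists (fun i => B i `&` C i) => [i|].
  exact: measurableI.
by apply/seteqP; split=> v /= => [[h1 h2] i|h]; [split|split=> i; case: (h i)].
Qed.

Definition upd (v : fvec) (i : I) (x : R) : fvec := fun j => if j == i then x else v j.

Variables (mu : probability fvec R) (g : I -> probability R R).
Hypothesis muE : forall B : I -> set R, (forall i, measurable (B i)) ->
  mu [set v | forall i, B i (v i)] = (\prod_i g i (B i))%E.

Local Open Scope ereal_scope.

Lemma measurable_upd (i : I) :
  measurable_fun setT (fun p : fvec * R => upd p.1 i p.2).
Proof.
have m1 : measurable_fun setT (fst : fvec * R -> fvec) by exact: measurable_fst.
apply: measurable_to_fvec => j; rewrite /upd; case: eqP => _; first exact: measurable_snd.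
exact: (measurableT_comp (measurable_coord j) m1).
Qed.

(** By uniqueness of measures on a pi-system only rectangles matter. There the old coordinate
    becomes unconstrained and the new one contributes [g i (B i)], giving back the same product. *)
Lemma law_upd (i : I) (C : set fvec) : measurable C ->
  mu C = pushforward (mu \x g i) (fun p => upd p.1 i p.2) C.
Proof.
move=> mC; have mu' := measurable_upd i.
pose nu' : {measure set fvec -> \bar R} := pushforward (mu \x g i) (fun p => upd p.1 i p.2).
pose nu := nu' mu'.
suff: mu C = nu C by [].
apply: (@measure_unique _ _ fvec rectangles (fun=> setT) _ _ _ _ mu nu) => //.
- exact: rectangles_setI.
- by move=> _; exists (fun=> setT) => //; apply/seteqP; split.
- by rewrite bigcup_const //; exists 0%N.
- move=> _ [B mB ->]; rewrite /nu /nu' /= /pushforward /=.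
  pose B' j := if j == i then setT else B j.
  have mB' j : measurable (B' j) by rewrite /B'; case: ifP.
  rewrite (_ : _ @^-1` _ = [set v : fvec | forall j, B' j (v j)] `*` B i); last first.
    apply/seteqP; split=> -[v x] /=; rewrite /upd /B'.
      move=> h; split; last by have := h i; rewrite eqxx.
      by move=> j; have := h j; case: ifP.
    by move=> [h1 h2] j; have := h1 j; case: eqP => [->|].
  rewrite product_measure1E //; last by apply: measurable_forall_fin => j;
    have := measurable_coord j measurableT (mB' j); rewrite setTI.
  rewrite (muE mB) [X in _ = X * _](_ : _ = \prod_j g j (B' j)); last exact: muE.
  rewrite (bigD1 i) //= [X in _ = X * _](bigD1 i) //= (_ : B' i = setT) ?probability_setT ?mul1e; last by rewrite /B' eqxx.
  rewrite muleC; congr (_ * _); apply: eq_bigr => j /negbTE ji; by rewrite /B' ji.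
- by move=> _; exact: le_lt_trans (probability_le1 mu measurableT) (ltry _).
Qed.

(** The substitute for conditioning on all coordinates except [i]. *)
Lemma resample (i : I) (F : fvec -> \bar R) :
  measurable_fun setT F -> (forall v, 0 <= F v) ->
  measurable_fun setT (fun v => \int[g i]_x F (upd v i x)) /\
  \int[mu]_v F v = \int[mu]_v \int[g i]_x F (upd v i x).
Proof.
move=> mF F0; have mu' := measurable_upd i.
have mF' : measurable_fun setT (fun p : fvec * R => F (upd p.1 i p.2)).
  exact: (measurableT_comp mF).
split; first exact: (measurable_fun_fubini_tonelli_F (fun p : fvec * R => F (upd p.1 i p.2))).
pose nu' : {measure set fvec -> \bar R} := pushforward (mu \x g i) (fun p => upd p.1 i p.2).
pose nu := nu' mu'.
transitivity (\int[nu]_v F v).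
  by apply: eq_measure_integral => C mC _; exact: law_upd.
rewrite ge0_integral_pushforward // preimage_setT.
exact: (fubini_tonelli1 (fun p => F (upd p.1 i p.2))).
Qed.

End ProductSpace.

(** * Gaussian integrals *)

Section IteratedIntegral.
Variable R : realType.
Local Open Scope ereal_scope.

Definition fcons n (x : R) (w : 'I_n -> R) : 'I_n.+1 -> R :=
  fun i => oapp w x (unlift ord0 i).

(** Iterated rather than over a product measure, so no joint measurability of the integrand has to
    be carried along. The coordinate [ord0] is the innermost one. *)
Fixpoint iterint (g : probability R R) n : (('I_n -> R) -> \bar R) -> \bar R :=
  if n is n'.+1 then
    fun h => iterint g (fun w => \int[g]_x h (fcons x w))
  else fun h => h (fun=> 0%R).

Lemma fcons0 n (x : R) (w : 'I_n -> R) : fcons x w ord0 = x.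
Proof. by rewrite /fcons unlift_none. Qed.

Lemma fconsS n (x : R) (w : 'I_n -> R) i : fcons x w (lift ord0 i) = w i.
Proof. by rewrite /fcons liftK. Qed.

Lemma eq_iterint g n (h k : ('I_n -> R) -> \bar R) :
  (forall w, h w = k w) -> iterint g h = iterint g k.
Proof. by move=> /funext ->. Qed.

(* For triangular T the first coordinate occurs in the first entry of T^T w only. *)
Lemma iterint_gauss_trig (s : R) n (T : 'M[R]_n) (c : R) : (0 < s)%R -> (0 <= c)%R ->
  is_trig_mx T -> (forall i, 0 < T i i)%R ->
  iterint (gauss s) (fun w : 'I_n -> R =>
    (c * expR (\sum_i ((w i / s) ^+ 2 / 2 - (\sum_j T j i * (w j / s)) ^+ 2 / 2)))%:E) =
  (c / \prod_i T i i)%:E.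
Proof.
move=> s0; elim: n T c => [|n IH] T c c0 /is_trig_mxP tT T0 /=.
  by rewrite !big_ord0 expR0 invr1.
pose T' : 'M[R]_n := \matrix_(i, j) T (lift ord0 i) (lift ord0 j).
have T00 : T ord0 ord0 != 0%R by rewrite gt_eqF.
have tT' : is_trig_mx T' by apply/is_trig_mxP => i j ij; rewrite mxE tT.
rewrite big_ord_recl invfM mulrA.
transitivity (c / T ord0 ord0 / \prod_i T' i i)%:E; last first.
  by congr (_ / _)%:E; apply: eq_bigr => i _; rewrite mxE.
rewrite -IH ?divr_ge0 ?(ltW (T0 _)) // => [|i]; last by rewrite mxE.
apply: eq_iterint => w.
pose b := (\sum_j T (lift ord0 j) ord0 * (w j / s))%R.
pose E := (\sum_i ((w i / s) ^+ 2 / 2 - (\sum_j T' j i * (w j / s)) ^+ 2 / 2))%R.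
transitivity (\int[gauss s]_x ((c * expR E)%:E *
   (expR ((x / s) ^+ 2 / 2 - (T ord0 ord0 * (x / s) + b) ^+ 2 / 2))%:E)).
  apply: eq_integral => x _; rewrite -EFinM -mulrA -expRD; congr (_ * expR _)%:E.
  rewrite big_ord_recl fcons0 addrC; congr (_ + (_ - _ ^+ 2 / 2))%R.
    apply: eq_bigr => i _; rewrite fconsS; congr (_ - _ ^+ 2 / 2)%R.
    rewrite big_ord_recl tT // mul0r add0r.
    by apply: eq_bigr => j _; rewrite fconsS mxE.
  rewrite big_ord_recl fcons0; congr (_ + _)%R.
  by apply: eq_bigr => j _; rewrite fconsS.
rewrite ge0_integralZl //.
- by rewrite integral_gauss_expR // -EFinM mulrAC.
- apply/measurable_EFinP; apply: measurableT_comp => //.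
  by apply: measurable_funB; apply: measurable_funM => //; apply: measurable_funX;
    repeat (apply: measurable_funD || apply: measurable_funM).
- by rewrite lee_fin mulr_ge0 ?expR_ge0.
Qed.

(** For $S=TT^\top$ the form is $|T^\top u|^2$ and $\sqrt{\det S}=\prod_i T_{ii}$, which normalises
    the weight to mass one. The constant [c] will carry the weight of the coordinates that are not
    integrated. *)
Lemma iterint_gauss (s : R) n (S : 'M[R]_n) (c : R) : (0 < s)%R -> (0 <= c)%R -> posdef S ->
  iterint (gauss s) (fun w : 'I_n -> R =>
    (c * expR (ln (\det S) / 2 -
       dot (\col_i (w i / s)) ((S - 1%:M) *m \col_i (w i / s)) / 2))%:E) = c%:E.
Proof.
move=> s0 c0 pS; have [T [tT T0 ES]] := cholesky pS.
have [dS dT] := posdef_detE tT T0 ES.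
transitivity (iterint (gauss s) (fun w : 'I_n -> R =>
  (c * \prod_i T i i *
   expR (\sum_i ((w i / s) ^+ 2 / 2 - (\sum_j T j i * (w j / s)) ^+ 2 / 2)))%:E)); last first.
  rewrite iterint_gauss_trig // ?(mulr_ge0 c0 (ltW dT)) //.
  by congr EFin; apply: mulfK; rewrite gt_eqF.
apply: eq_iterint => w; congr EFin; rewrite -mulrA expRD; congr (_ * (_ * expR _))%R.
  by rewrite dS lnXn // -[(ln _ *+ 2)%R]mulr_natr mulfK ?lnK ?posrE // pnatr_eq0.
rewrite sumrB -!mulr_suml -mulrBl -mulNr; congr (_ / _)%R.
set u := \col_i _; rewrite mulmxBl dotBr mul1mx opprB; congr (_ - _)%R.
  by rewrite dotE; apply: eq_bigr => i _; rewrite !mxE expr2.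
rewrite ES -mulmxA dot_mulr dotE; apply: eq_bigr => i _.
by rewrite !mxE -expr2; congr (_ ^+ 2)%R; apply: eq_bigr => j _; rewrite !mxE.
Qed.

End IteratedIntegral.

Section Blocks.
Variables (R : realType) (I : finType).
Variables (mu : probability (fvec R I) R) (g : I -> probability R R).
Hypothesis muE : forall B : I -> set R, (forall i, measurable (B i)) ->
  mu [set v | forall i, B i (v i)] = (\prod_i g i (B i))%E.

Local Open Scope ereal_scope.

Definition updb n (iota : 'I_n -> I) (w : 'I_n -> R) (v : fvec R I) : fvec R I :=
  fun i => if [pick j | iota j == i] is Some j then w j else v i.

Lemma updb_in n (iota : 'I_n -> I) w v j : injective iota -> updb iota w v (iota j) = w j.
Proof.
move=> inj; rewrite /updb; case: pickP => [k /eqP/inj -> //|/(_ j)].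
by rewrite eqxx.
Qed.

Lemma updb_out n (iota : 'I_n -> I) w v i : (forall j, iota j != i) -> updb iota w v i = v i.
Proof.
by move=> h; rewrite /updb; case: pickP => // j; rewrite (negbTE (h j)).
Qed.

Lemma updb_fcons n (iota : 'I_n.+1 -> I) x w v : injective iota ->
  updb iota (fcons x w) v = upd (updb (iota \o lift ord0) w v) (iota ord0) x.
Proof.
move=> inj; apply/funext => i; rewrite /upd.
have inj' : injective (iota \o lift ord0) by move=> a b /inj/lift_inj.
case: eqP => [->|/eqP ni]; first by rewrite updb_in // fcons0.
case: (pickP (fun j => iota j == i)) => [j /eqP ij|nij].
  rewrite -ij updb_in //; case: (unliftP ord0 j) => [k jk|j0].
    by rewrite jk fconsS -/((iota \o lift ord0) k) updb_in.
  by rewrite -ij j0 eqxx in ni.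
by rewrite !updb_out // => j; apply/negbT; exact: nij.
Qed.

Lemma resample_block (h : probability R R) n (iota : 'I_n -> I) (F : fvec R I -> \bar R) :
  injective iota -> (forall j, g (iota j) = h) ->
  measurable_fun setT F -> (forall v, 0 <= F v) ->
  \int[mu]_v F v = \int[mu]_v iterint h (fun w => F (updb iota w v)).
Proof.
elim: n iota F => [|n IH] iota F inj gh mF F0.
  apply: eq_integral => v _ /=; congr F; apply/funext => i.
  by rewrite updb_out // => -[].
have [mF1 ->] := resample muE (iota ord0) mF F0.
have inj' : injective (iota \o lift ord0) by move=> a b /inj/lift_inj.
have F10 v : 0 <= \int[g (iota ord0)]_x F (upd v (iota ord0) x) by apply: integral_ge0.
rewrite (IH (iota \o lift ord0) _ inj' (fun j => gh _) mF1 F10).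
apply: eq_integral => v _ /=; apply: eq_iterint => w.
by rewrite gh; apply: eq_integral => x _; rewrite updb_fcons.
Qed.

End Blocks.

(** * Chernoff bounds for Gaussian quadratic forms *)

Section MeasurableMatrices.
Variables (R : realType) (d : measure_display) (T : measurableType d).

(** Writing $x^{-1}=x\cdot(x^2)^{-1}$ reduces the claim to real powers of a nonnegative base; at
    $x=0$ both sides are 0 by convention. *)
Lemma measurable_invr : measurable_fun setT (fun x : R => x^-1).
Proof.
have -> : (fun x : R => x^-1) = (fun x => x * (x ^+ 2) `^ (-1)).
  apply/funext => x; rewrite powR_inv1 ?sqr_ge0 //.
  have [->|x0] := eqVneq x 0; first by rewrite invr0 mul0r.
  by rewrite expr2 invfM mulrA mulfV // mul1r.
apply: measurable_funM => //.
have m2 : measurable_fun setT (fun x : R => x ^+ 2) by exact: measurable_funX.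
exact: (measurableT_comp (@measurable_powR R (-1)) m2).
Qed.

Lemma measurable_gt_set (f : T -> R) t :
  measurable_fun setT f -> measurable [set v | t < f v].
Proof.
move=> mf; have := mf measurableT _ (measurable_itv `]t, +oo[); rewrite setTI.
by congr measurable; apply/seteqP; split=> v /=; rewrite in_itv /= andbT.
Qed.

Definition mxmeas m n (M : T -> 'M[R]_(m, n)) :=
  forall i j, measurable_fun setT (fun t => M t i j).

Lemma mxmeas_cst m n (M : 'M[R]_(m, n)) : mxmeas (fun=> M).
Proof. by move=> i j. Qed.

Lemma mxmeasD m n (M N : T -> 'M[R]_(m, n)) :
  mxmeas M -> mxmeas N -> mxmeas (fun t => M t + N t).
Proof.
move=> mM mN i j; rewrite (_ : (fun t => _) = fun t => M t i j + N t i j).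
  exact: measurable_funD.
by apply/funext => t; rewrite mxE.
Qed.

Lemma mxmeasZ m n (a : T -> R) (M : T -> 'M[R]_(m, n)) :
  measurable_fun setT a -> mxmeas M -> mxmeas (fun t => a t *: M t).
Proof.
move=> ma mM i j; rewrite (_ : (fun t => _) = fun t => a t * M t i j).
  exact: measurable_funM.
by apply/funext => t; rewrite mxE.
Qed.

Lemma mxmeasN m n (M : T -> 'M[R]_(m, n)) : mxmeas M -> mxmeas (fun t => - M t).
Proof.
move=> mM; rewrite (_ : (fun t => _) = fun t => (-1) *: M t).
  by apply: mxmeasZ.
by apply/funext => t; rewrite scaleN1r.
Qed.

Lemma mxmeasB m n (M N : T -> 'M[R]_(m, n)) :
  mxmeas M -> mxmeas N -> mxmeas (fun t => M t - N t).
Proof. by move=> mM mN; apply: mxmeasD => //; exact: mxmeasN. Qed.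

Lemma mxmeasM m n p (M : T -> 'M[R]_(m, n)) (N : T -> 'M[R]_(n, p)) :
  mxmeas M -> mxmeas N -> mxmeas (fun t => M t *m N t).
Proof.
move=> mM mN i j; rewrite (_ : (fun t => _) = fun t => \sum_k M t i k * N t k j).
  by apply: measurable_sum => k; exact: measurable_funM.
by apply/funext => t; rewrite mxE.
Qed.

Lemma mxmeas_tr m n (M : T -> 'M[R]_(m, n)) : mxmeas M -> mxmeas (fun t => (M t)^T).
Proof.
by move=> mM i j; rewrite (_ : (fun t => _) = fun t => M t j i) //; apply/funext => t; rewrite mxE.
Qed.

Lemma measurable_det n (M : T -> 'M[R]_n) :
  mxmeas M -> measurable_fun setT (fun t => \det (M t)).
Proof.
move=> mM; rewrite /determinant; apply: measurable_sum => s.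
by apply: measurable_funM => //; apply: measurable_prod => i _.
Qed.

Lemma mxmeas_adj n (M : T -> 'M[R]_n) : mxmeas M -> mxmeas (fun t => \adj (M t)).
Proof.
move=> mM i j.
rewrite (_ : (fun t => _) = fun t => (-1) ^+ (j + i) * \det (row' j (col' i (M t)))).
  apply: measurable_funM => //; apply: measurable_det => a b.
  by rewrite (_ : (fun t => _) = fun t => M t (lift j a) (lift i b)) //; apply/funext => t; rewrite !mxE.
by apply/funext => t; rewrite mxE.
Qed.

(* Agrees with [invmx] on invertible matrices and depends measurably on the entries. *)
Definition adjinv n (M : 'M[R]_n) := (\det M)^-1 *: \adj M.

Lemma adjinvE n (M : 'M[R]_n) : M \in unitmx -> adjinv M = invmx M.
Proof. by rewrite /invmx => ->. Qed.

Lemma mxmeas_adjinv n (M : T -> 'M[R]_n) : mxmeas M -> mxmeas (fun t => adjinv (M t)).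
Proof.
move=> mM; apply: mxmeasZ; last exact: mxmeas_adj.
exact: (measurableT_comp measurable_invr (measurable_det mM)).
Qed.

Lemma measurable_dot n (u v : T -> 'cV[R]_n) :
  mxmeas u -> mxmeas v -> measurable_fun setT (fun t => dot (u t) (v t)).
Proof. by move=> mu mv; apply: mxmeasM => //; exact: mxmeas_tr. Qed.

Lemma measurable_trmx n (M : T -> 'M[R]_n) :
  mxmeas M -> measurable_fun setT (fun t => \tr (M t)).
Proof. by move=> mM; apply: measurable_sum. Qed.

End MeasurableMatrices.

Section Chernoff.
Variables (R : realType) (I : finType).
Variables (mu : probability (fvec R I) R) (g : I -> probability R R).
Hypothesis muE : forall B : I -> set R, (forall i, measurable (B i)) ->
  mu [set v | forall i, B i (v i)] = (\prod_i g i (B i))%E.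
Variables (J : eqType) (n : nat) (iota : J -> 'I_n -> I) (s : R).
Hypotheses (s0 : 0 < s) (iota_inj : forall l l' j j', iota l j = iota l' j' -> l = l' /\ j = j').
Hypothesis giota : forall l j, g (iota l j) = gauss s :> probability R R.
Variables (G : set (fvec R I)) (S : fvec R I -> 'M[R]_n).
Hypotheses (mG : measurable G) (mS : mxmeas S) (pS : forall v, G v -> posdef (S v)).

Definition block l (v : fvec R I) : 'cV[R]_n := \col_j (v (iota l j) / s).

(** Functional dependence in place of conditional independence: [S] and [G] read only coordinates
    outside the blocks listed in [js]. *)
Definition indep_of (js : seq J) := forall v v' : fvec R I,
  (forall i, (forall l j, l \in js -> iota l j != i) -> v i = v' i) ->
  S v = S v' /\ (G v <-> G v').

(** When [S v] is positive definite, this is the log density of $N(0,S^{-1})$ relative to $N(0,1)$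
    at block [l]. *)
Let loglik l v : R := ln (\det (S v)) / 2 - dot (block l v) ((S v - 1%:M) *m block l v) / 2.

Let dens js v : R := \1_G v * expR (\sum_(l <- js) loglik l v).

Lemma mxmeas_block l : mxmeas (block l).
Proof.
move=> i j; rewrite (_ : (fun t => _) = fun v : fvec R I => v (iota l i) / s).
  by apply: measurable_funM => //; exact: measurable_coord.
by apply/funext => v; rewrite mxE.
Qed.

Let measurable_loglik l : measurable_fun setT (loglik l).
Proof.
apply: measurable_funB; apply: measurable_funM => //.
  exact: (measurableT_comp (@measurable_ln R) (measurable_det mS)).
apply: measurable_dot; first exact: mxmeas_block.
apply: mxmeasM; last exact: mxmeas_block.
by apply: mxmeasB => //; exact: mxmeas_cst.
Qed.

Let measurable_dens js : measurable_fun setT (dens js).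
Proof.
apply: measurable_funM; first exact: measurable_indic.
by apply: measurableT_comp => //; exact: measurable_sum.
Qed.

Local Open Scope ereal_scope.

(** Blocks are integrated out one at a time: redrawing one changes neither [S], nor [G], nor the
    other blocks, and its factor has mean one. What remains at the end is [mu G]. *)
Let integral_dens js : uniq js -> indep_of js -> \int[mu]_v (dens js v)%:E <= 1.
Proof.
elim: js => [|l js IH] /=.
  move=> _ _; rewrite (eq_integral (fun v => (\1_G v)%:E)) => [|v _].
    by rewrite integral_indic // setIT probability_le1.
  by rewrite /dens big_nil expR0 mulr1.
move=> /andP[ljs ujs] ind.
have ind' : indep_of js.
  move=> v v' vv'; apply: ind => i h; apply: vv' => l' j l'js.
  by apply: h; rewrite inE l'js orbT.
apply: le_trans (IH ujs ind'); rewrite le_eqVlt; apply/orP; left; apply/eqP.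
have dens0 js' v : 0 <= (dens js' v)%:E by rewrite lee_fin mulr_ge0 ?expR_ge0.
have inj : injective (iota l) by move=> j j' /iota_inj[].
rewrite [LHS](resample_block muE inj (giota l)) //; last exact/measurable_EFinP.
apply: eq_integral => v _.
have upd_ind w : S (updb (iota l) w v) = S v /\ (G (updb (iota l) w v) <-> G v).
  apply: ind => i h; rewrite updb_out // => j; apply: h.
  exact: mem_head.
have blockl w : block l (updb (iota l) w v) = \col_j (w j / s)%R.
  by apply/colP => j; rewrite !mxE updb_in.
have loglik_js w : (\sum_(l' <- js) loglik l' (updb (iota l) w v) = \sum_(l' <- js) loglik l' v)%R.
  rewrite !big_seq; apply: eq_bigr => l' l'js.
  suff E : block l' (updb (iota l) w v) = block l' v.
    by rewrite /loglik E (proj1 (upd_ind w)).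
  apply/colP => j; rewrite !mxE updb_out // => j'.
  by apply/eqP => /iota_inj[ll' _]; rewrite ll' l'js in ljs.
have indG w : \1_G (updb (iota l) w v) = \1_G v :> R.
  rewrite !indicE; have [h1 h2] := proj2 (upd_ind w).
  by congr ((nat_of_bool _)%:R); apply/idP/idP => /set_mem h; apply/mem_set; auto.
have E w : dens (l :: js) (updb (iota l) w v) = (dens js v * expR (ln (\det (S v)) / 2 -
       dot (\col_i (w i / s)) ((S v - 1%:M) *m \col_i (w i / s)) / 2))%R.
  have El : loglik l (updb (iota l) w v) = (ln (\det (S v)) / 2 -
       dot (\col_i (w i / s)) ((S v - 1%:M) *m \col_i (w i / s)) / 2)%R.
    by rewrite /loglik blockl (proj1 (upd_ind w)).
  by rewrite /dens big_cons indG loglik_js El -mulrA -expRD addrC.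
transitivity (iterint (gauss s) (fun w => (dens js v * expR (ln (\det (S v)) / 2 -
  dot (\col_i (w i / s)) ((S v - 1%:M) *m \col_i (w i / s)) / 2))%:E)).
  by apply: eq_iterint => w; rewrite E.
have [Gv|nGv] := pselect (G v).
  by rewrite (iterint_gauss s0 _ (pS Gv)) // mulr_ge0 ?expR_ge0.
(* Outside [G] the matrix [S v] need not be positive definite, but the weight vanishes, so the
   identity matrix can take its place with [c = 0]. *)
have d0 : dens js v = 0%R by rewrite /dens indicE memNset // mul0r.
rewrite d0 -[RHS](iterint_gauss s0 (lexx 0%R) (posdef1 R n)).
by apply: eq_iterint => w; rewrite !mul0r.
Qed.

(** Markov's inequality for [dens js], which exceeds $e^t$ on [Q]. Since [S] may vary with the
    remaining coordinates, this is a conditional Chernoff bound. *)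
Lemma gauss_chernoff js t (Q : set (fvec R I)) : uniq js -> indep_of js -> measurable Q ->
  (forall v, Q v -> G v /\ (t < (size js)%:R / 2 * ln (\det (S v)) -
    (\sum_(l <- js) dot (block l v) ((S v - 1%:M) *m block l v)) / 2)%R) ->
  mu Q <= (expR (- t))%:E.
Proof.
move=> ujs ind mQ QG.
have L v : ((size js)%:R / 2 * ln (\det (S v)) -
    (\sum_(l <- js) dot (block l v) ((S v - 1%:M) *m block l v)) / 2 =
    \sum_(l <- js) loglik l v)%R.
  rewrite /loglik sumrB -!mulr_suml big_const_seq count_predT iter_addr_0.
  by rewrite -[(ln _ *+ _)%R]mulr_natl mulrAC.
rewrite -[X in mu X]setIT -integral_indic //.
apply: (@le_trans _ _ (\int[mu]_v ((expR (- t))%:E * (dens js v)%:E))).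
  apply: ge0_le_integral => //.
  - exact/measurable_EFinP/measurable_indic.
  - by apply/measurable_EFinP; apply: measurable_funM.
  - move=> v _; rewrite -EFinM lee_fin /dens !indicE.
    have [Qv|nQ] := pselect (Q v); last by rewrite memNset // !mulr_ge0 ?expR_ge0.
    have [Gv] := QG v Qv; rewrite L => tv.
    rewrite !mem_set // mul1r -expRD -expR0 ler_expR /=.
    by rewrite addrC subr_ge0 ltW.
rewrite ge0_integralZl //.
- rewrite -[leRHS]mule1; apply: lee_pmul => //; last exact: integral_dens.
  by apply: integral_ge0 => v _; rewrite lee_fin mulr_ge0 ?expR_ge0.
- exact/measurable_EFinP.
- by move=> v _; rewrite lee_fin mulr_ge0 ?expR_ge0.
Qed.

End Chernoff.

(** * Almost sure invertibility *)

Section NullSets.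
Variables (R : realType) (I : finType).
Variables (mu : probability (fvec R I) R) (g : I -> probability R R).
Hypothesis muE : forall B : I -> set R, (forall i, measurable (B i)) ->
  mu [set v | forall i, B i (v i)] = (\prod_i g i (B i))%E.

Lemma measurable_eq0 d (T : measurableType d) (f : T -> R) :
  measurable_fun setT f -> measurable [set v | f v = 0].
Proof.
move=> mf; have := mf measurableT _ (measurable_set1 0); rewrite setTI.
by congr measurable; apply/seteqP; split.
Qed.

(** With the other coordinates frozen, [f] is affine in coordinate [i] with slope [p]; a nonzero
    slope leaves a single root, which an atomless law does not charge. *)
Lemma null_affine (i : I) (p f : fvec R I -> R) : (forall x : R, g i [set x] = 0%E) ->
  measurable_fun setT p -> measurable_fun setT f ->
  (forall v x, p (upd v i x) = p v) ->
  (forall v x, f (upd v i x) = p v * x + f (upd v i 0)) ->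
  mu [set v | p v <> 0 /\ f v = 0] = 0%E.
Proof.
move=> gx mp mf pU fU; set Q := [set v | _].
have mQ : measurable Q.
  apply: measurableI; last exact: measurable_eq0.
  by apply: measurableC; exact: measurable_eq0.
have mI : measurable_fun setT (fun v => (\1_Q v)%:E : \bar R).
  exact/measurable_EFinP/measurable_indic.
have I0 v : (0 <= (\1_Q v)%:E :> \bar R)%E by rewrite lee_fin.
rewrite -[X in mu X]setIT -integral_indic //.
have [_ ->] := resample muE i mI I0.
rewrite -(integral0 mu setT); apply: eq_integral => v _.
have [p0|p0] := eqVneq (p v) 0.
  rewrite -(integral0 (g i) setT); apply: eq_integral => x _.
  by rewrite indicE memNset // => -[]; rewrite pU p0.
apply/eqP; rewrite eq_le; apply/andP; split; last exact: integral_ge0.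
rewrite -[leRHS](gx (- f (upd v i 0) / p v)) -[X in (_ <= g i X)%E]setIT -integral_indic //.
apply: ge0_le_integral => //.
- apply/measurable_EFinP; apply: (@measurableT_comp _ _ _ _ _ _ (\1_Q : fvec R I -> R)).
    exact: measurable_indic.
  apply: measurable_to_fvec => j; rewrite /upd; case: eqP => _ //.
- exact/measurable_EFinP/measurable_indic.
- move=> x _; rewrite lee_fin !indicE.
  have [[_ fx]|nQ] := pselect (Q (upd v i x)); last by rewrite memNset.
  rewrite (mem_set (A := [set _])) ?ler_pMn2r // => [|/=]; first by case: (_ \in Q).
  move: fx; rewrite fU => /eqP; rewrite addr_eq0 => /eqP <-.
  by rewrite mulrC mulKf.
Qed.

End NullSets.

Section LeadingMinors.
Variables (R : realType) (m n : nat) (J : finType).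
Local Notation I := ('I_m * 'I_n + J)%type.
Variables (mu : probability (fvec R I) R) (g : I -> probability R R).
Hypothesis muE : forall B : I -> set R, (forall i, measurable (B i)) ->
  mu [set v | forall i, B i (v i)] = (\prod_i g i (B i))%E.
Hypothesis g_atomless : forall ij x, g (inl ij) [set x] = 0%E.
Hypothesis le_mn : (m <= n)%N.

Definition Amx (v : fvec R I) : 'M[R]_(m, n) := \matrix_(i, j) v (inl (i, j)).

Lemma mxmeas_Amx : mxmeas Amx.
Proof.
move=> i j; rewrite (_ : (fun v => _) = fun v : fvec R I => v (inl (i, j))).
  exact: measurable_coord.
by apply/funext => v; rewrite mxE.
Qed.

Let minor k (km : (k <= m)%N) (v : fvec R I) : 'M[R]_k :=
  \matrix_(i, j) v (inl (widen_ord km i, widen_ord (leq_trans km le_mn) j)).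

Let mxmeas_minor k (km : (k <= m)%N) : mxmeas (minor km).
Proof.
move=> i j; rewrite (_ : (fun v => _) = 
  fun v : fvec R I => v (inl (widen_ord km i, widen_ord (leq_trans km le_mn) j))).
  exact: measurable_coord.
by apply/funext => v; rewrite mxE.
Qed.

(** Expanded along its last row, a leading minor is affine in its corner entry, with the previous
    leading minor as slope. Induction and [null_affine] conclude. *)
Let null_minor k (km : (k <= m)%N) : mu [set v | \det (minor km v) = 0] = 0%E.
Proof.
elim: k km => [|k IH] km.
  rewrite (_ : [set v | _] = set0) ?measure0 //.
  by apply/seteqP; split=> v //=; rewrite det_mx00 => /eqP; rewrite oner_eq0.
have km' := ltnW km.
pose i0 : I := inl (Ordinal km, Ordinal (leq_trans km le_mn)).
have cofE v : cofactor (minor km v) ord_max ord_max = \det (minor km' v).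
  rewrite /cofactor -signr_odd oddD addbb expr0 mul1r; congr (\det _).
  apply/matrixP => a b; rewrite !mxE; congr (v (inl (_, _))); apply: val_inj;
    by rewrite /= /bump leqNgt ltn_ord.
have cofU v x j : cofactor (minor km (upd v i0 x)) ord_max j = cofactor (minor km v) ord_max j.
  rewrite /cofactor; congr (_ * \det _); apply/matrixP => a b; rewrite !mxE /upd.
  case: eqP => // /(congr1 (fun u : I => if u is inl p then val p.1 else 0%N)) /= ea; exfalso.
  by rewrite /bump leqNgt (ltn_ord a) add0n in ea; have := ltn_ord a; rewrite /= ea ltnn.
have := @null_affine _ _ _ _ muE i0 (fun v => \det (minor km' v)) (fun v => \det (minor km v)).
move=> /(_ (g_atomless _)).
move=> /(_ (measurable_det (mxmeas_minor _)) (measurable_det (mxmeas_minor _))) H.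
have {}H : mu [set v | \det (minor km' v) <> 0 /\ \det (minor km v) = 0] = 0%E.
  apply: H => [v x|v x]; first by rewrite -!cofE cofU.
  have detU y : \det (minor km (upd v i0 y)) = \det (minor km' v) * y +
      \sum_(j | j != ord_max) minor km v ord_max j * cofactor (minor km v) ord_max j.
    rewrite (expand_det_row _ ord_max) (bigD1 ord_max) //= cofU cofE mulrC; congr (_ * _ + _).
      rewrite mxE /upd; case: eqP => // ne; exfalso; apply: ne.
      by congr (inl (_, _)); apply: val_inj.
    apply: eq_bigr => j jmax; rewrite cofU; congr (_ * _); rewrite !mxE /upd.
    case: eqP => // /(congr1 (fun u : I => if u is inl p then val p.2 else 0%N)) /= ej.
    case/eqP: jmax; exact: val_inj.
  by rewrite !detU mulr0 add0r.
have mm k' (km1 : (k' <= m)%N) : measurable [set v | \det (minor km1 v) = 0].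
  exact: measurable_eq0 (measurable_det (mxmeas_minor _)).
apply/eqP; rewrite eq_le measure_ge0 andbT.
pose Q1 := [set v | \det (minor km' v) = 0].
pose Q2 := [set v | \det (minor km' v) <> 0 /\ \det (minor km v) = 0].
have mQ2 : measurable Q2 by apply: measurableI; [apply: measurableC|]; exact: mm.
have mQ1 : measurable Q1 by exact: mm.
have sub : [set v | \det (minor km v) = 0] `<=` Q1 `|` Q2.
  by move=> v h; have [e|e] := pselect (\det (minor km' v) = 0); [left|right].
apply: (@le_trans _ _ (mu (Q1 `|` Q2))).
  by apply: le_measure => //; rewrite inE; [exact: mm|exact: measurableU].
apply: (le_trans (measureU2 _ mQ1 mQ2)).
by rewrite [X in (X + _ <= _)%E](IH km') [X in (_ + X <= _)%E]H adde0.
Qed.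

Lemma null_det_gram : mu [set v | \det (Amx v *m (Amx v)^T) = 0] = 0%E.
Proof.
apply/eqP; rewrite eq_le measure_ge0 andbT -(null_minor (leqnn m)).
have mm : measurable [set v | \det (minor (leqnn m) v) = 0].
  exact: measurable_eq0 (measurable_det (mxmeas_minor _)).
apply: le_measure; rewrite ?inE //.
  apply: measurable_eq0; apply: measurable_det; apply: mxmeasM; first exact: mxmeas_Amx.
  by apply: mxmeas_tr; exact: mxmeas_Amx.
(* A null vector [z] of the Gram matrix has $|A^\top z|=0$, so it also annihilates the leading
   square block of [A]. *)
move=> v /= /eqP/det0P[z z0 zA].
apply/eqP/det0P; exists z => //.
have /eqP : dot ((Amx v)^T *m z^T) ((Amx v)^T *m z^T) = 0.
  have E : Amx v *m (Amx v)^T *m z^T = 0.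
    have <- : (Amx v *m (Amx v)^T)^T = Amx v *m (Amx v)^T by rewrite trmx_mul trmxK.
    by rewrite -trmx_mul zA trmx0.
  by rewrite dot_mull trmxK mulmxA E dot0r.
have [Az0 _|/dot_gt0 + /eqP e0] := eqVneq ((Amx v)^T *m z^T) 0; last by rewrite e0 ltxx.
apply/rowP => j; rewrite !mxE.
have := congr1 (fun M : 'cV_n => M (widen_ord (leq_trans (leqnn m) le_mn) j) 0) Az0.
rewrite !mxE => {2}<-; apply: eq_bigr => i _; rewrite !mxE mulrC; congr (v (inl (_, _)) * _).
exact: val_inj.
Qed.

End LeadingMinors.

(** * Operator norm and Frobenius norm *)

Section UnionBound.
Variables (R : realType) (d : measure_display) (T : measurableType d).
Variable (mu : probability T R).
Local Open Scope ereal_scope.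

Lemma measurable_exists_fin (K : finType) (F : K -> set T) :
  (forall k, measurable (F k)) -> measurable [set t | exists k, F k t].
Proof.
move=> mF; have -> : [set t | exists k, F k t] = \bigcup_(k in [set: K]) F k.
  by apply/seteqP; split=> t /= [k]; exists k.
exact: fin_bigcup_measurable.
Qed.

Lemma union_bound (K : finType) (F : K -> set T) (a : K -> R) :
  (forall k, measurable (F k)) -> (forall k, mu (F k) <= (a k)%:E) ->
  mu [set t | exists k, F k t] <= (\sum_k a k)%:E.
Proof.
move=> mF Fa.
suff H (s : seq K) : measurable [set t | exists2 k, k \in s & F k t] /\
    mu [set t | exists2 k, k \in s & F k t] <= (\sum_(k <- s) a k)%:E.
  have [_] := H (index_enum K); congr (mu _ <= _).
  by apply/seteqP; split=> t /= [k]; exists k => //; exact: mem_index_enum.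
elim: s => [|k s [ms IH]].
  have -> : [set t | exists2 k, k \in [::] & F k t] = set0.
    by apply/seteqP; split=> t // [].
  by rewrite measure0 big_nil.
have -> : [set t | exists2 j, j \in k :: s & F j t] =
    F k `|` [set t | exists2 j, j \in s & F j t].
  apply/seteqP; split=> t /=.
    by move=> [j]; rewrite inE => /predU1P[->|js] Fj; [left|right; exists j].
  by move=> [Fk|[j js Fj]]; [exists k; rewrite ?mem_head|exists j; rewrite // inE js orbT].
split; first exact: measurableU.
rewrite big_cons EFinD.
by apply: (le_trans (measureU2 _ (mF k) ms)); exact: (leeD (Fa k) IH).
Qed.

End UnionBound.

(** * Operator norms from an integer net *)

Section OperatorNormNet.
Variable R : realType.

(* Integer vectors in sign-magnitude form; zero has two codes, which only
   weakens the union bound. *)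
Definition zvec m (z : {ffun 'I_m -> bool * 'I_(2 * m).+1}) : 'cV[R]_m :=
  \col_i ((-1) ^+ (z i).1 * (z i).2%:R).

Lemma dot_zvec m (z : {ffun 'I_m -> bool * 'I_(2 * m).+1}) :
  dot (zvec z) (zvec z) = \sum_i (z i).2%:R ^+ 2.
Proof.
rewrite dotE; apply: eq_bigr => i _.
by rewrite !mxE -expr2 exprMn -exprM mulnC exprM sqrrN expr1n expr1n mul1r.
Qed.

(** Coordinates are rounded towards zero: this cannot increase the norm and moves each by less than
    1. As $|v_i|\le 2\sqrt m\le 2m$, the magnitudes fit the code. *)
Lemma zvec_net m (v : 'cV[R]_m) : dot v v <= (4 * m)%:R ->
  exists z, dot (zvec z) (zvec z) <= (4 * m)%:R /\
    dot (v - zvec z) (v - zvec z) <= m%:R.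
Proof.
move=> vm.
have vi i : `|v i 0| ^+ 2 <= (4 * m)%:R.
  apply: le_trans vm; rewrite dotE (bigD1 i) //= real_normK ?num_real // -expr2 lerDl.
  by apply: sumr_ge0 => j _; rewrite -expr2 sqr_ge0.
have ti i : (Num.truncn `|v i 0|%R <= 2 * m)%N.
  rewrite leqNgt truncn_gt_nat //; apply/negP => h.
  have : ((2 * m).+1%:R : R) ^+ 2 <= (4 * m)%:R.
    by apply: le_trans (vi i); rewrite lerXn2r // nnegrE.
  by rewrite -natrX ler_nat leqNgt => /negP; apply; lia.
pose z := [ffun i => (v i 0 < 0, inord (Num.truncn `|v i 0|) : 'I_(2 * m).+1)].
have z2 i : (z i).2 = Num.truncn `|v i 0| :> nat by rewrite ffunE /= inordK // ltnS.
have tv i := truncn_itv (normr_ge0 (v i 0)).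
exists z; split.
  rewrite dot_zvec; apply: le_trans vm; rewrite dotE; apply: ler_sum => i _.
  have /andP[h _] := tv i.
  rewrite z2 -expr2 -[leRHS]real_normK ?num_real // lerXn2r ?nnegrE //.
have -> : m%:R = \sum_(i < m) 1 :> R by rewrite sumr_const card_ord.
rewrite dotE.
apply: ler_sum => i _; rewrite !mxE z2 ffunE /=.
have /andP[h1 h2] := tv i; rewrite -natr1 in h2.
case: ltP => s; rewrite /= ?expr1 ?expr0 ?mul1r ?mulN1r.
  move: h1 h2; rewrite ltr0_norm //; nra.
by move: h1 h2; rewrite ger0_norm //; nra.
Qed.

Lemma dot_mulmx_le_frob m n (M : 'M[R]_(m, n)) u :
  dot (M *m u) (M *m u) <= frob M * dot u u.
Proof.
rewrite -frob_tr /frob dot_tr mulr_suml dotE; apply: ler_sum => i _.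
have -> : (M *m u) i 0 = dot (col i M^T) u.
  by rewrite mxE dotE; apply: eq_bigr => j _; rewrite !mxE.
exact: CauchySchwarz.
Qed.

Lemma opnorm_of_net m n (M : 'M[R]_(n, m)) (B : R) : (0 < m)%N -> 0 <= B ->
  (forall z, dot (zvec z) (zvec z) <= (4 * m)%:R ->
     dot (M *m zvec z) (M *m zvec z) <= m%:R * B) ->
  forall u, dot (M *m u) (M *m u) <= B * dot u u.
Proof.
move=> m0 B0 HB; have mR0 : 0 < m%:R :> R by rewrite ltr0n.
have step S : 0 <= S -> (forall u, dot (M *m u) (M *m u) <= S * dot u u) ->
    forall u, dot (M *m u) (M *m u) <= (B + S) / 2 * dot u u.
  move=> S0 HS u; have [->|u0] := eqVneq u 0; first by rewrite mulmx0 !dot0r mulr0.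
  have uu := dot_gt0 u0.
  pose c := Num.sqrt (4 * m%:R / dot u u).
  have cc : c ^+ 2 = 4 * m%:R / dot u u.
    by rewrite sqr_sqrtr // divr_ge0 ?mulr_ge0 ?(ltW uu).
  have [z [zm ez]] : exists z, dot (zvec z) (zvec z) <= (4 * m)%:R /\
      dot (c *: u - zvec z) (c *: u - zvec z) <= m%:R.
    by apply: zvec_net; rewrite dotZl dotZr mulrA -expr2 cc divfK ?gt_eqF // natrM.
  have par (a b : 'cV[R]_n) : dot (a + b) (a + b) <= 2 * dot a a + 2 * dot b b.
    have := dot_ge0 (a - b); rewrite !(dotDl, dotDr, dotNl, dotNr) (dotC b a); lra.
  have := par (M *m zvec z) (M *m (c *: u - zvec z)).
  rewrite -mulmxDr addrC subrK -scalemxAr dotZl dotZr mulrA -expr2 cc.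
  have h1 := HB z zm; have h2 := HS (c *: u - zvec z).
  have h3 : S * dot (c *: u - zvec z) (c *: u - zvec z) <= S * m%:R by rewrite ler_wpM2l.
  move=> h4.
  have : 4 * m%:R / dot u u * dot (M *m u) (M *m u) <= 2 * m%:R * (B + S) by lra.
  rewrite mulrAC ler_pdivrMr // => h5.
  rewrite -(ler_pM2l (_ : 0 < 4 * m%:R)); first by apply: le_trans h5 _; lra.
  by rewrite mulr_gt0.
set S0 := frob M; have S00 : 0 <= S0.
  by rewrite /S0 /frob tr_frob sumr_ge0 // => i _; rewrite sumr_ge0 // => j _; rewrite sqr_ge0.
have iter k : forall u, dot (M *m u) (M *m u) <= (B + S0 / 2 ^+ k) * dot u u.
  elim: k => [|k IH] u.
    rewrite expr0 divr1; apply: le_trans (dot_mulmx_le_frob M u) _.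
    by rewrite ler_wpM2r ?dot_ge0 // lerDr.
  have -> : B + S0 / 2 ^+ k.+1 = (B + (B + S0 / 2 ^+ k)) / 2.
    by rewrite exprS invfM; field; rewrite expf_neq0.
  by apply: step IH u; rewrite addr_ge0 // divr_ge0 // exprn_ge0.
move=> u; rewrite leNgt; apply/negP => lt.
set e := dot (M *m u) (M *m u) - B * dot u u.
have e0 : 0 < e by rewrite subr_gt0.
(* Enough halvings to bring the surplus [S0 * dot u u / 2 ^+ k.+1] below the supposed excess [e]. *)
pose k := Num.truncn (S0 * dot u u / e).
have := iter k.+1 u; rewrite mulrDl -lerBlDl -/e.
have : S0 * dot u u / e < k.+1%:R by apply: real_truncnS_gt; rewrite num_real.
rewrite ltr_pdivrMr // => h1; rewrite mulrAC ler_pdivlMr ?exprn_gt0 //.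
apply/negP; rewrite -ltNge; apply: (lt_trans h1); rewrite mulrC ltr_pM2l //.
by rewrite -natrX ltr_nat ltn_expl.
Qed.

Lemma sum_half_pow N : \sum_(k < N) (2^-1 : R) ^+ k <= 2.
Proof.
suff -> : \sum_(k < N) (2^-1 : R) ^+ k = 2 - 2 * 2^-1 ^+ N.
  by rewrite lerBlDl lerDr mulr_ge0 // exprn_ge0.
elim: N => [|N IH]; first by rewrite big_ord0 expr0; ring.
by rewrite big_ord_recr /= IH exprS; field.
Qed.

(** This replaces counting net points: the weight factorises over coordinates, each factor being at
    most $2\cdot 2\le e^2$. A code with $|z|^2\le 4m$ weighs at least $e^{-4m}$. *)
Lemma sum_zvec_weight m :
  \sum_(z : {ffun 'I_m -> bool * 'I_(2 * m).+1}) expR (- dot (zvec z) (zvec z))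
  <= expR (2 * m%:R).
Proof.
under eq_bigr do rewrite dot_zvec -sumrN expR_sum.
rewrite -(bigA_distr_bigA (fun (_ : 'I_m) (p : bool * 'I_(2 * m).+1) =>
  expR (- (p.2%:R ^+ 2)))) /=.
rewrite prodr_const card_ord mulrC expRM_natl.
apply: lerXn2r; rewrite ?nnegrE ?expR_ge0 //.
  by apply: sumr_ge0 => p _; rewrite expR_ge0.
have -> : \sum_(p : bool * 'I_(2 * m).+1) expR (- (p.2%:R ^+ 2)) =
    2 * \sum_(k < (2 * m).+1) expR (- (k%:R ^+ 2)) :> R.
  rewrite -(pair_big xpredT xpredT (fun (b : bool) (k : 'I_(2 * m).+1) =>
    expR (- (k%:R ^+ 2)))) /= big_bool /=; ring.
have e1 : 2 <= expR 1 :> R by have := expR_ge1Dx (1 : R).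
have : \sum_(k < (2 * m).+1) expR (- (k%:R ^+ 2)) <= 2 :> R.
  apply: le_trans (sum_half_pow (2 * m).+1); apply: ler_sum => k _.
  apply: (@le_trans _ _ (expR (- k%:R))).
    by rewrite ler_expR lerN2 -natrX ler_nat expnS expn1; case: (val k) => // j; nia.
  rewrite -(mulr1 k%:R) -mulrN expRM_natl lerXn2r ?nnegrE ?expR_ge0 ?invr_ge0 //.
  by rewrite expRN lef_pV2 ?posrE ?expR_gt0.
have -> : expR 2 = expR 1 * expR 1 :> R by rewrite -expRD.
nra.
Qed.

End OperatorNormNet.

Section DiagonalForms.
Variable R : realType.

Lemma dot_diag n (e : 'rV[R]_n) u : dot u (diag_mx e *m u) = \sum_i e 0 i * u i 0 ^+ 2.
Proof.
rewrite dotE; apply: eq_bigr => i _; rewrite mul_diag_mx !mxE; ring.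
Qed.

Lemma posdef_sandwich m n (A : 'M[R]_(m, n)) (e : 'rV[R]_n) :
  \det (A *m A^T) <> 0 -> (forall i, 0 < e 0 i) -> posdef (A *m diag_mx e *m A^T).
Proof.
move=> dA e0; split=> [|u u0].
  by rewrite !trmx_mul trmxK tr_diag_mx mulmxA.
rewrite -!mulmxA dot_mulr dot_diag.
have [Au0|Au0] := eqVneq (A^T *m u) 0.
  exfalso; case: dA; apply/eqP/det0P; exists u^T.
    by apply: contra u0 => /eqP/(congr1 trmx); rewrite trmxK trmx0 => ->.
  by rewrite mulmxA (_ : u^T *m A = (A^T *m u)^T); [rewrite Au0 trmx0 mul0mx|rewrite trmx_mul trmxK].
have [i Aui] : exists i, (A^T *m u) i 0 != 0.
  apply/existsP; apply: contraT => /existsPn h; case/eqP: Au0; apply/colP => i.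
  by rewrite [RHS]mxE; apply/eqP; move: (h i); rewrite negbK.
rewrite (bigD1 i) //= ltr_pwDl //; first by rewrite mulr_gt0 ?e0 // exprn_even_gt0.
by apply: sumr_ge0 => j _; rewrite mulr_ge0 ?sqr_ge0 // ltW.
Qed.

Lemma posdef_1Dgram n k (B : 'M[R]_(k, n)) c : 0 <= c -> posdef (1%:M + c *: (B^T *m B)).
Proof.
move=> c0; split=> [|u u0].
  by rewrite linearD linearZ /= trmx1 trmx_mul trmxK.
rewrite mulmxDl mul1mx dotDr -scalemxAl dotZr -mulmxA dot_mulr trmxK.
by rewrite ltr_pwDl ?dot_gt0 ?mulr_ge0 ?dot_ge0.
Qed.

Lemma ln_half_ge : -1 <= ln (2^-1 : R).
Proof.
rewrite lnV ?posrE // lerN2; have := @le_ln1Dx R 1; rewrite -[1 + 1]/2.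
by apply; lra.
Qed.

Lemma dot_outer n (z a : 'cV[R]_n) : dot a (z *m z^T *m a) = dot z a ^+ 2.
Proof. by rewrite -mulmxA dot_mulr dotE big_ord1 -/(dot z a) expr2. Qed.

End DiagonalForms.

Section Model.
Variables (R : realType) (m n L : nat) (sw : R).
Hypothesis sw0 : 0 < sw.
Local Notation I := ('I_m * 'I_n + 'I_L * 'I_n)%type.

Definition model_law (i : I) : probability R R :=
  if i is inl _ then gauss 1 else gauss sw.

Variable mu : probability (fvec R I) R.
Hypothesis muE : forall B : I -> set R, (forall i, measurable (B i)) ->
  mu [set v | forall i, B i (v i)] = (\prod_i model_law i (B i))%E.

Local Notation A := (@Amx R m n ('I_L * 'I_n)%type).

Definition noise (l : 'I_L) (v : fvec R I) : 'cV[R]_n := \col_j (v (inr (l, j)) / sw).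

Lemma mxmeas_noise l : mxmeas (noise l).
Proof. exact: (mxmeas_block (fun (l : 'I_L) j => inr (l, j) : I) sw l). Qed.

(** Chernoff with [S] equal to half the identity: energy above $6Ln$ contributes more than $3Ln/2$,
    and the log determinant costs at most $Ln/2$. *)
Lemma noise_tail :
  (mu [set v | (6 * L%:R * n%:R < \sum_l dot (noise l v) (noise l v))%R]
   <= (expR (- (L%:R * n%:R)))%:E)%E.
Proof.
have pS : posdef ((2^-1)%:M : 'M[R]_n).
  by rewrite -(mulr1 2^-1) -scale_scalar_mx; apply: posdefZ; [lra|exact: posdef1].
have iinj (l l' : 'I_L) (j j' : 'I_n) : inr (l, j) = inr (l', j') :> I -> l = l' /\ j = j'.
  by move=> [].
have ml (l : 'I_L) (j : 'I_n) : model_law (inr (l, j)) = gauss sw :> probability R R by [].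
apply: (@gauss_chernoff _ _ _ _ muE _ _ (fun (l : 'I_L) j => inr (l, j)) sw sw0 iinj ml
  setT (fun=> (2^-1)%:M) measurableT (mxmeas_cst _) (fun _ _ => pS) (enum 'I_L)
  (L%:R * n%:R) _ (enum_uniq _)) => //.
  apply: (@measurable_gt_set R _ (fvec R I) (fun v => \sum_l dot (noise l v) (noise l v))).
  apply: measurable_sum => l.
  exact: measurable_dot (mxmeas_noise l) (mxmeas_noise l).
move=> v /= h; split=> //.
rewrite big_enum /= -cardE card_ord det_scalar.
have -> : (2^-1)%:M - 1%:M = - ((2^-1)%:M) :> 'M[R]_n.
  by apply/matrixP => i j; rewrite !mxE; case: eqP => _ /=; field.
under eq_bigr do rewrite mulNmx mul_scalar_mx dotNr dotZr.
rewrite sumrN -mulr_sumr lnXn //.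
have L0 : 0 <= L%:R * n%:R / 2 :> R by rewrite !mulr_ge0.
have := ler_wpM2l L0 (ln_half_ge R).
rewrite -[ln _ *+ n]mulr_natl; lra.
Qed.

Lemma sum_dot_col (v : fvec R I) (z : 'cV[R]_m) :
  \sum_j dot z (col j (A v)) ^+ 2 = dot ((A v)^T *m z) ((A v)^T *m z).
Proof.
rewrite dotE; apply: eq_bigr => j _; rewrite -expr2; congr (_ ^+ 2).
by rewrite mxE dotE; apply: eq_bigr => i _; rewrite !mxE mulrC.
Qed.

(** The blocks are the $n$ columns of [A] and $S=1-c\,zz^\top$ with $c=1/(8m)$, so $\det
    S=1-c|z|^2\ge 1/2$. The form contributes more than $15n/2$ and the determinant costs at most
    $n/2$. *)
Lemma directional_tail (z : 'cV[R]_m) : (0 < m)%N -> dot z z <= (4 * m)%:R ->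
  (mu [set v | (120 * m%:R * n%:R < dot ((A v)^T *m z) ((A v)^T *m z))%R]
   <= (expR (- (7 * n%:R)))%:E)%E.
Proof.
move=> m0 zm; have mR : 0 < m%:R :> R by rewrite ltr0n.
pose c : R := (8 * m%:R)^-1.
have c0 : 0 < c by rewrite invr_gt0 mulr_gt0.
have cz : c * dot z z <= 2^-1.
  apply: le_trans (_ : c * (4 * m)%:R <= _); first by rewrite ler_pM2l.
  by rewrite [leLHS](_ : _ = 2^-1) // /c natrM; field; rewrite gt_eqF.
pose S : 'M[R]_m := 1%:M + (- c) *: (z *m z^T).
have dS : \det S = 1 - c * dot z z.
  rewrite /S scalemxAl det_1D_mulC -scalemxAr det_mx11.
  by rewrite mxE [X in X + _]mxE [X in _ + X]mxE eqxx -/(dot z z) mulNr.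
have qS u : dot u (S *m u) = dot u u - c * dot z u ^+ 2.
  by rewrite mulmxDl mul1mx dotDr -scalemxAl dotZr dot_outer mulNr.
have pS : posdef S.
  split=> [|u u0]; first by rewrite linearD linearZ /= trmx1 trmx_mul trmxK.
  have uu := dot_gt0 u0; rewrite qS; have := CauchySchwarz z u; nra.
have iinj (j j' : 'I_n) (p p' : 'I_m) : inl (p, j) = inl (p', j') :> I -> j = j' /\ p = p'.
  by move=> [-> ->].
have ml (j : 'I_n) (p : 'I_m) : model_law (inl (p, j)) = gauss 1 :> probability R R by [].
have mA : mxmeas (fun v : fvec R I => (A v)^T *m z).
  by apply: mxmeasM; [apply: mxmeas_tr; exact: mxmeas_Amx|exact: mxmeas_cst].
apply: (@gauss_chernoff _ _ _ _ muE _ _ (fun (j : 'I_n) p => inl (p, j)) 1 ltr01 iinj ml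
  setT (fun=> S) measurableT (mxmeas_cst _) (fun _ _ => pS) (enum 'I_n)
  (7 * n%:R) _ (enum_uniq _)) => //.
  apply: (@measurable_gt_set R _ (fvec R I) (fun v => dot ((A v)^T *m z) ((A v)^T *m z))).
  exact: measurable_dot.
move=> v /= h; split=> //.
rewrite big_enum /= -cardE card_ord dS.
have -> : S - 1%:M = (- c) *: (z *m z^T) by rewrite /S addrC addKr.
have E j : block (fun (j : 'I_n) p => inl (p, j) : I) 1 j v = col j (A v).
  by apply/colP => p; rewrite !mxE divr1.
under eq_bigr do rewrite E -scalemxAl dotZr dot_outer.
rewrite -mulr_sumr sum_dot_col mulNr -mulNr.
have ln1 : -1 <= ln (1 - c * dot z z).
  apply: le_trans (ln_half_ge R) _; rewrite ler_ln ?posrE ?invr_gt0 //; lra.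
have n0 : 0 <= n%:R / 2 :> R by rewrite mulr_ge0.
have := ler_wpM2l n0 ln1.
have : 120 * m%:R * n%:R * c < dot ((A v)^T *m z) ((A v)^T *m z) * c by rewrite ltr_pM2r.
have -> : 120 * m%:R * n%:R * c = 15 * n%:R by rewrite /c; field; rewrite gt_eqF.
lra.
Qed.

Definition opnorm_bad : set (fvec R I) :=
  [set v | exists z, dot (zvec R z) (zvec R z) <= (4 * m)%:R /\
    120 * m%:R * n%:R < dot ((A v)^T *m zvec R z) ((A v)^T *m zvec R z)].

Lemma opnorm_good v : (0 < m)%N -> ~ opnorm_bad v ->
  forall u, dot ((A v)^T *m u) ((A v)^T *m u) <= 120 * n%:R * dot u u.
Proof.
move=> m0 nb; apply: opnorm_of_net; rewrite ?mulr_ge0 // => z zm.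
rewrite leNgt; apply/negP => h; apply: nb; exists z; split=> //.
by have -> : 120 * m%:R * n%:R = m%:R * (120 * n%:R) :> R by ring.
Qed.

Lemma opnorm_tail : (0 < m)%N -> (m <= n)%N ->
  measurable opnorm_bad /\ (mu opnorm_bad <= (expR (- n%:R))%:E)%E.
Proof.
move=> m0 mn.
pose F z := if dot (zvec R z) (zvec R z) <= (4 * m)%:R then
  [set v | 120 * m%:R * n%:R < dot ((A v)^T *m zvec R z) ((A v)^T *m zvec R z)] else set0.
have mF z : measurable (F z).
  rewrite /F; case: ifP => // _.
  apply: (@measurable_gt_set R _ (fvec R I)
    (fun v => dot ((A v)^T *m zvec R z) ((A v)^T *m zvec R z))).
  have mA : mxmeas (fun v : fvec R I => (A v)^T *m zvec R z).
    by apply: mxmeasM; [apply: mxmeas_tr; exact: mxmeas_Amx|exact: mxmeas_cst].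
  exact: measurable_dot.
have -> : opnorm_bad = [set v | exists z, F z v].
  apply/seteqP; split=> v [z]; rewrite /F => h; exists z; move: h.
    by move=> [-> ?].
  by case: ifP.
split; first exact: measurable_exists_fin.
(* The factor $e^{4m-|z|^2}$ is at least 1 on the net, so it only weakens each bound $e^{-7n}$.
   Summation then gives $e^{-7n+4m+2m}\le e^{-n}$. *)
pose a (z : {ffun 'I_m -> bool * 'I_(2 * m).+1}) := expR (- (7 * n%:R) + (4 * m)%:R) * expR (- dot (zvec R z) (zvec R z)).
have Fa z : (mu (F z) <= (a z)%:E)%E.
  rewrite /F; case: ifPn => zm; last by rewrite measure0 lee_fin mulr_ge0 ?expR_ge0.
  apply: (le_trans (directional_tail m0 zm)).
  by rewrite lee_fin /a -expRD ler_expR; lra.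
apply: (le_trans (union_bound mF Fa)); rewrite lee_fin -mulr_sumr.
apply: (@le_trans _ _ (expR (- (7 * n%:R) + (4 * m)%:R) * expR (2 * m%:R))).
  by rewrite ler_pM2l ?expR_gt0 // sum_zvec_weight.
have : m%:R <= n%:R :> R by rewrite ler_nat.
by rewrite -expRD ler_expR natrM; lra.
Qed.

End Model.

(** * Lower tails after splitting the rows of [A] *)

Section FrobeniusLowerBound.
Variables (R : realType) (m n L : nat) (sw : R).
Local Notation I := ('I_m * 'I_n + 'I_L * 'I_n)%type.
Variable mu : probability (fvec R I) R.
Hypothesis muE : forall B : I -> set R, (forall i, measurable (B i)) ->
  mu [set v | forall i, B i (v i)] = (\prod_i model_law sw i (B i))%E.
Local Notation A := (@Amx R m n ('I_L * 'I_n)%type).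

Lemma dot_diag_le k (e : 'rV[R]_k) c u : (forall i, `|e 0 i| <= c) ->
  dot (diag_mx e *m u) (diag_mx e *m u) <= c ^+ 2 * dot u u.
Proof.
move=> ec; rewrite dot_mull tr_diag_mx mulmxA mulmx_diag dot_diag dotE mulr_sumr.
apply: ler_sum => i _; rewrite -expr2 ler_wpM2r ?sqr_ge0 // mxE -expr2.
by rewrite -real_normK ?num_real // lerXn2r ?nnegrE ?(le_trans (normr_ge0 _) (ec i)).
Qed.

(** Zeroes all rows from [q] on instead of deleting them, which keeps the format and avoids
    reindexing. *)
Definition selmx q : 'M[R]_m := diag_mx (\row_p (p < q)%:R).

Lemma dot_selmx_le q u : dot (selmx q *m u) (selmx q *m u) <= dot u u.
Proof.
rewrite -[leRHS]mul1r -(expr1n _ 2); apply: dot_diag_le => i.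
by rewrite mxE; case: (i < q)%N; rewrite ?normr1 ?normr0.
Qed.

Variable q : nat.
Hypothesis qm : (q <= m)%N.
Variable d : 'rV[R]_n.
Local Notation D := (diag_mx d).

Definition topmx (v : fvec R I) : 'M[R]_(m, n) := selmx q *m A v *m D.
Local Notation B := topmx.

Lemma mxmeas_topmx : mxmeas B.
Proof.
apply: mxmeasM; last exact: mxmeas_cst.
by apply: mxmeasM; [exact: mxmeas_cst|exact: mxmeas_Amx].
Qed.

Lemma topmxE v i j : B v i j = (i < q)%:R * A v i j * d 0 j.
Proof.
by rewrite /topmx mul_mx_diag mxE /selmx mul_diag_mx mxE [X in X * _ * _]mxE.
Qed.

Let row_iota (p : 'I_m) (j : 'I_n) : I := inl (p, j).

Let row_inj p p' j j' : row_iota p j = row_iota p' j' -> p = p' /\ j = j'.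
Proof. by move=> [-> ->]. Qed.

Let row_law p j : model_law sw (row_iota p j) = gauss 1 :> probability R R.
Proof. by []. Qed.

Let block_row p v : block row_iota 1 p v = col p (A v)^T.
Proof. by apply/colP => j; rewrite !mxE divr1. Qed.

Let top := [seq p : 'I_m <- enum 'I_m | (p < q)%N].
Let bot := [seq p : 'I_m <- enum 'I_m | ~~ (p < q)%N].

Let size_top : size top = q.
Proof.
rewrite -sum1_size big_filter big_enum_cond /= -(big_ord_widen _ (fun=> 1%N) qm).
by rewrite sum1_card card_ord.
Qed.

Let size_bot : size bot = (m - q)%N.
Proof.
have := count_predC (fun p : 'I_m => (p < q)%N) (enum 'I_m).
rewrite -!size_filter -/top -/bot size_top -cardE card_ord; lia.
Qed.

Lemma frob_topmx v :
  frob (B v) = \sum_(p : 'I_m | (p < q)%N) dot (D *m col p (A v)^T) (D *m col p (A v)^T).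
Proof.
rewrite /frob tr_frob [RHS]big_mkcond; apply: eq_bigr => p _; rewrite dotE.
case: ifPn => pq.
  apply: eq_bigr => j _; rewrite topmxE pq mul1r !mul_diag_mx !mxE; ring.
by rewrite big1 // => j _; rewrite topmxE (negbTE pq) !mul0r expr0n.
Qed.

Let T2 := \sum_j d 0 j ^+ 2.
Let T4 := \sum_j d 0 j ^+ 4.

Definition top_bad lam t : set (fvec R I) :=
  [set v | lam * frob (B v) < q%:R * (lam * T2 - 2 * lam ^+ 2 * T4) - t].

Lemma measurable_frob k l (M : fvec R I -> 'M[R]_(k, l)) :
  mxmeas M -> measurable_fun setT (fun v => frob (M v)).
Proof. by move=> mM; apply: measurable_trmx; apply: mxmeasM => //; exact: mxmeas_tr. Qed.

Lemma measurable_lt_set (f h : fvec R I -> R) :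
  measurable_fun setT f -> measurable_fun setT h -> measurable [set v | f v < h v].
Proof.
move=> mf mh; have := @measurable_gt_set R _ (fvec R I) (fun v => h v - f v) 0.
move=> /(_ (measurable_funB mh mf)); congr measurable.
by apply/seteqP; split=> v /=; rewrite subr_gt0.
Qed.

(** Each top row contributes a form with matrix $D^2$. The Chernoff matrix is $1+2\lambda D^2$, and
    [ln_det_1D_ge] bounds its log determinant below by the mean term minus a variance term;
    $\lambda$ is left free. *)
Lemma top_tail lam t : 0 < lam -> measurable (top_bad lam t) /\
  (mu (top_bad lam t) <= (expR (- t))%:E)%E.
Proof.
move=> lam0.
have mQ : measurable (top_bad lam t).
  apply: measurable_lt_set => //.
  by apply: measurable_funM => //; apply: measurable_frob; exact: mxmeas_topmx.
split=> //.
have l20 : 0 <= 2 * lam by rewrite mulr_ge0 // ltW.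
pose S : 'M[R]_n := 1%:M + (2 * lam) *: (D^T *m D).
have pS : posdef S := posdef_1Dgram D l20.
apply: (@gauss_chernoff _ _ _ _ muE _ _ row_iota 1 ltr01 row_inj row_law
  setT (fun=> S) measurableT (mxmeas_cst _) (fun _ _ => pS) top t) => //.
  by rewrite filter_uniq // enum_uniq.
move=> v; rewrite /top_bad /= => h; split=> //.
have -> : S - 1%:M = (2 * lam) *: (D^T *m D) by rewrite /S addrC addKr.
rewrite size_top.
under eq_bigr do rewrite block_row -scalemxAl dotZr -mulmxA -dot_mull.
rewrite -mulr_sumr /top big_filter big_enum_cond /= -frob_topmx.
have : 2 * lam * T2 - 4 * lam ^+ 2 * T4 <= ln (\det S).
  have sD : ((2 * lam) *: (D^T *m D))^T = (2 * lam) *: (D^T *m D).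
    by rewrite linearZ /= trmx_mul trmxK.
  have pD u : 0 <= dot u ((2 * lam) *: (D^T *m D) *m u).
    by rewrite -scalemxAl dotZr -mulmxA -dot_mull mulr_ge0 ?dot_ge0.
  apply: le_trans (ln_det_1D_ge sD pD).
  rewrite -scalemxAl -scalemxAr !mxtraceZ tr_diag_mx !mulmx_diag !mxtrace_diag.
  have -> : \sum_i (\row_j (d 0 j * d 0 j)) 0 i = T2.
    by apply: eq_bigr => j _; rewrite mxE expr2.
  set T := \sum_i _; have -> : T = T4 by apply: eq_bigr => j _; rewrite !mxE; ring.
  by rewrite le_eqVlt; apply/orP; left; apply/eqP; ring.
have q0 : 0 <= q%:R / 2 :> R by rewrite mulr_ge0.
move=> /(ler_wpM2l q0); lra.
Qed.

(** The squared entries of $ADA^\top$ with row index below [q] and column index at least [q], that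
    is, an off-diagonal block. *)
Definition bot_energy v := \sum_(p : 'I_m | ~~ (p < q)%N)
  dot (B v *m col p (A v)^T) (B v *m col p (A v)^T).

Definition bot_bad lam t : set (fvec R I) :=
  [set v | lam * bot_energy v <
    (m - q)%:R * (lam * frob (B v) - 2 * lam ^+ 2 * frob ((B v)^T *m B v)) - t].

Lemma bot_tail lam t : 0 < lam -> measurable (bot_bad lam t) /\
  (mu (bot_bad lam t) <= (expR (- t))%:E)%E.
Proof.
move=> lam0; have mB := mxmeas_topmx.
have mA : mxmeas A by exact: mxmeas_Amx.
have mQ : measurable (bot_bad lam t).
  apply: measurable_lt_set.
    apply: measurable_funM => //.
    rewrite (_ : bot_energy = fun v => \sum_(p <- bot)
        dot (B v *m col p (A v)^T) (B v *m col p (A v)^T)); last first.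
      by apply/funext => v; rewrite big_filter big_enum_cond.
    apply: measurable_sum => p.
    have mBr : mxmeas (fun v => B v *m col p (A v)^T).
      apply: mxmeasM => // i j.
      rewrite (_ : (fun v => _) = fun v => A v p i) //.
      by apply/funext => v; rewrite !mxE.
    exact: measurable_dot.
  apply: measurable_funB => //; apply: measurable_funM => //; apply: measurable_funB.
    by apply: measurable_funM => //; exact: measurable_frob.
  apply: measurable_funM => //; apply: measurable_frob; apply: mxmeasM => //.
  exact: mxmeas_tr.
split=> //.
have l20 : 0 <= 2 * lam by rewrite mulr_ge0 // ltW.
pose S v : 'M[R]_n := 1%:M + (2 * lam) *: ((B v)^T *m B v).
have pS v : posdef (S v) := posdef_1Dgram (B v) l20.
have mS : mxmeas S.
  apply: mxmeasD; first exact: mxmeas_cst.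
  by apply: mxmeasZ => //; apply: mxmeasM => //; exact: mxmeas_tr.
apply: (@gauss_chernoff _ _ _ _ muE _ _ row_iota 1 ltr01 row_inj row_law
  setT S measurableT mS (fun v _ => pS v) bot t) => //.
- by rewrite filter_uniq // enum_uniq.
(* The Chernoff matrix is now random, but [topmx] reads only rows below [q], while the integrated
   blocks are the other rows. *)
- move=> v v' vv'; split=> //; rewrite /S; suff -> : B v = B v' by [].
  apply/matrixP => i j; rewrite !topmxE; case: ltnP => iq; last by rewrite !mul0r.
  rewrite !mxE vv' // => p j' pbot; apply/eqP => -[pi _].
  by move: pbot; rewrite pi mem_filter iq.
move=> v; rewrite /bot_bad /= => h; split=> //.
have -> : S v - 1%:M = (2 * lam) *: ((B v)^T *m B v) by rewrite /S addrC addKr.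
rewrite size_bot.
under eq_bigr do rewrite block_row -scalemxAl dotZr -mulmxA -dot_mull.
rewrite -mulr_sumr /bot big_filter big_enum_cond /= -/(bot_energy v).
have : 2 * lam * frob (B v) - 4 * lam ^+ 2 * frob ((B v)^T *m B v) <= ln (\det (S v)).
  have sD : ((2 * lam) *: ((B v)^T *m B v))^T = (2 * lam) *: ((B v)^T *m B v).
    by rewrite linearZ /= trmx_mul trmxK.
  have pD u : 0 <= dot u ((2 * lam) *: ((B v)^T *m B v) *m u).
    by rewrite -scalemxAl dotZr -mulmxA -dot_mull mulr_ge0 ?dot_ge0.
  apply: le_trans (ln_det_1D_ge sD pD).
  rewrite -scalemxAl -scalemxAr !mxtraceZ /frob [((B v)^T *m B v)^T]trmx_mul trmxK.
  rewrite le_eqVlt; apply/orP; left; apply/eqP; ring.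
have q0 : 0 <= (m - q)%:R / 2 :> R by rewrite mulr_ge0.
move=> /(ler_wpM2l q0); lra.
Qed.

Lemma bot_energy_le v : bot_energy v <= frob (A v *m D *m (A v)^T).
Proof.
rewrite /bot_energy /frob dot_tr big_mkcond; apply: ler_sum => p _.
case: ifP => _; last exact: dot_ge0.
rewrite /topmx !colE -!mulmxA.
by rewrite (mulmxA (A v)) (mulmxA (A v *m D)); exact: dot_selmx_le.
Qed.

(** $|B^\top B|_F^2\le\|B\|^2|B|_F^2\le\|B\|^4 m$ with $\|B\|^2\le D_0^2\kappa$. Passing to $B^\top$
    for the second step yields the factor $m$ rather than $n$. *)
Lemma frob_topmx_gram_le v kappa D0 : 0 <= kappa -> 0 <= D0 -> (forall j, `|d 0 j| <= D0) ->
  (forall u, dot ((A v)^T *m u) ((A v)^T *m u) <= kappa * dot u u) ->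
  frob ((B v)^T *m B v) <= (D0 ^+ 2 * kappa) ^+ 2 * m%:R.
Proof.
move=> k0 D00 dD Ak; have kB0 : 0 <= D0 ^+ 2 * kappa by rewrite mulr_ge0 ?sqr_ge0.
have kB u : dot ((B v)^T *m u) ((B v)^T *m u) <= D0 ^+ 2 * kappa * dot u u.
  rewrite /topmx !trmx_mul tr_diag_mx /selmx tr_diag_mx -/(selmx q) -!mulmxA.
  apply: le_trans (dot_diag_le _ dD) _; rewrite -mulrA ler_wpM2l ?sqr_ge0 //.
  by apply: le_trans (Ak _) _; rewrite ler_wpM2l // dot_selmx_le.
rewrite expr2 -mulrA; apply: le_trans (frob_mull _ kB) _; rewrite ler_wpM2l //.
rewrite -frob_tr -[X in frob X]mulmx1; apply: le_trans (frob_mull _ kB) _.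
by rewrite /frob trmx1 mulmx1 mxtrace1.
Qed.

End FrobeniusLowerBound.

Lemma sqr_le_halves m : (2 <= m)%N -> (m ^ 2 <= (m - m./2) * m./2 * 6)%N.
Proof.
move=> m2; set q := m./2.
have [e1 e2] : m = (odd m + 2 * q)%N /\ (m - q)%N = (odd m + q)%N by rewrite /q; lia.
have q1 : (1 <= q)%N by rewrite /q; lia.
rewrite e2 [in leqLHS]e1 expnS expn1; case: (odd m) => /=; nia.
Qed.

Section GramLowerTail.
Variables (R : realType) (m n L : nat) (sw : R).
Local Notation I := ('I_m * 'I_n + 'I_L * 'I_n)%type.
Variable mu : probability (fvec R I) R.
Hypothesis muE : forall B : I -> set R, (forall i, measurable (B i)) ->
  mu [set v | forall i, B i (v i)] = (\prod_i model_law sw i (B i))%E.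
Local Notation A := (@Amx R m n ('I_L * 'I_n)%type).

Lemma gram_lower_tail (d : 'rV[R]_n) (D0 t : R) : (2 <= m)%N -> (m <= n)%N -> 0 < D0 ->
  (forall j, `|d 0 j| <= D0) -> 0 < t ->
  exists Bad : set (fvec R I), [/\ measurable Bad, (mu Bad <= (2 * expR (- t))%:E)%E &
    forall v, ~ Bad v -> ~ opnorm_bad v ->
      m%:R ^+ 2 / 6 * (\sum_j d 0 j ^+ 2) - 363 * D0 ^+ 2 * m%:R * n%:R * Num.sqrt t
      <= frob (A v *m diag_mx d *m (A v)^T)].
Proof.
move=> m2 mn D00 dD t0.
have mR : 0 < m%:R :> R by rewrite ltr0n; lia.
have nR : 0 < n%:R :> R by rewrite ltr0n; lia.
have mnR : m%:R <= n%:R :> R by rewrite ler_nat.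
set s := Num.sqrt t; have s0 : 0 < s by rewrite sqrtr_gt0.
have ss : t = s * s by rewrite -expr2 sqr_sqrtr // ltW.
have DD : 0 < D0 ^+ 2 by rewrite exprn_gt0.
set c := D0 ^+ 2 in DD *.
pose q := m./2; have qm : (q <= m)%N by rewrite /q; lia.
pose kB := c * (120 * n%:R).
have kB0 : 0 < kB by rewrite !mulr_gt0.
(* Each $\lambda$ makes its variance term at most $2t$. Together with the deviation $t$ this loses
   $3t$, that is $3\sqrt t\,nc$ and $3\sqrt t\,m\,$[kB] after division by $\lambda$. *)
pose lam1 := s / (n%:R * c); pose lam2 := s / (m%:R * kB).
have lam10 : 0 < lam1 by rewrite divr_gt0 ?mulr_gt0.
have lam20 : 0 < lam2 by rewrite divr_gt0 ?mulr_gt0.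
have [m1 P1] := top_tail muE qm d t lam10.
have [m3 P3] := bot_tail muE qm d t lam20.
exists (top_bad q d lam1 t `|` bot_bad q d lam2 t); split.
- exact: measurableU.
- apply: (le_trans (measureU2 _ m1 m3)).
  by rewrite mulr_natl mulr2n EFinD; exact: leeD.
move=> v /not_orP[/negP + /negP +] nop; rewrite -!leNgt => h1 h2.
have op := opnorm_good (ltnW m2) nop.
have h3 := bot_energy_le q d v.
have h4 : frob ((topmx q d v)^T *m topmx q d v) <= kB ^+ 2 * m%:R.
  by apply: frob_topmx_gram_le op; rewrite ?mulr_ge0 ?(ltW D00) // ltW.
set T2 := \sum_j d 0 j ^+ 2 in h1 *; set T4 := \sum_j d 0 j ^+ 4 in h1.
have T20 : 0 <= T2 by apply: sumr_ge0 => j _; rewrite sqr_ge0.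
have T40 : 0 <= T4 by apply: sumr_ge0 => j _; rewrite exprn_even_ge0.
have T4le : T4 <= n%:R * c ^+ 2.
  have -> : n%:R * c ^+ 2 = \sum_(j < n) c ^+ 2.
    by rewrite sumr_const card_ord mulr_natl.
  apply: ler_sum => j _; rewrite /c -exprM -[leLHS]ger0_norm ?exprn_even_ge0 //.
  by rewrite normrX lerXn2r // nnegrE // ltW.
set F := frob (topmx q d v) in h1 h2.
set E := bot_energy q d v in h2 h3.
set G := frob (_ *m topmx q d v) in h2 h4.
have G0 : 0 <= G.
  by rewrite /G /frob dot_tr; apply: sumr_ge0 => j _; exact: dot_ge0.
set H := frob _ in h3 *.
have qR : q%:R <= m%:R :> R by rewrite ler_nat.
have q0 : 0 <= q%:R :> R by [].
have hF : q%:R * T2 - 3 * s * n%:R * c <= F.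
  rewrite -(ler_pM2l lam10); apply: le_trans h1.
  have e1 : lam1 * (n%:R * c) = s by rewrite divfK // gt_eqF // mulr_gt0.
  have : q%:R * (2 * lam1 ^+ 2 * T4) <= 2 * t.
    apply: (@le_trans _ _ (n%:R * (2 * lam1 ^+ 2 * (n%:R * c ^+ 2)))).
      apply: ler_pM => //; first by rewrite mulr_ge0 // mulr_ge0 // sqr_ge0.
        exact: le_trans qR mnR.
      by rewrite ler_wpM2l // mulr_ge0 // sqr_ge0.
    by rewrite le_eqVlt ss -[in X in _ == X]e1; apply/orP; left; apply/eqP; ring.
  have -> : lam1 * (q%:R * T2 - 3 * s * n%:R * c) = q%:R * (lam1 * T2) - 3 * (s * (lam1 * (n%:R * c))).
    by ring.
  by rewrite e1 -ss; lra.
set p := (m - q)%N in h2.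
have pR : p%:R <= m%:R :> R by rewrite ler_nat leq_subr.
have hE : p%:R * F - 3 * s * m%:R * kB <= E.
  rewrite -(ler_pM2l lam20); apply: le_trans h2.
  have e2 : lam2 * (m%:R * kB) = s by rewrite divfK // gt_eqF // mulr_gt0.
  have : p%:R * (2 * lam2 ^+ 2 * G) <= 2 * t.
    apply: (@le_trans _ _ (m%:R * (2 * lam2 ^+ 2 * (kB ^+ 2 * m%:R)))).
      apply: ler_pM => //; first by rewrite mulr_ge0 // mulr_ge0 // sqr_ge0.
      by rewrite ler_wpM2l // mulr_ge0 // sqr_ge0.
    by rewrite le_eqVlt ss -[in X in _ == X]e2; apply/orP; left; apply/eqP; ring.
  have -> : lam2 * (p%:R * F - 3 * s * m%:R * kB) = p%:R * (lam2 * F) - 3 * (s * (lam2 * (m%:R * kB))).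
    by ring.
  by rewrite e2 -ss; lra.
(* The constant 363 is $3\cdot 120$ from the bottom rows plus 3 from the top rows; the factor $1/6$
   comes from $(m-q)q\ge m^2/6$. *)
apply: le_trans h3; apply: le_trans hE.
have pq : m%:R ^+ 2 / 6 <= p%:R * q%:R :> R.
  by rewrite ler_pdivrMr // -natrX -!natrM ler_nat sqr_le_halves.
have h5 : p%:R * (q%:R * T2 - 3 * s * n%:R * c) <= p%:R * F by rewrite ler_wpM2l.
have h6 : m%:R ^+ 2 / 6 * T2 <= p%:R * q%:R * T2 by rewrite ler_wpM2r.
have h7 : p%:R * (3 * s * n%:R * c) <= m%:R * (3 * s * n%:R * c).
  by rewrite ler_wpM2r // !mulr_ge0 // ltW.
by rewrite /kB; lra.
Qed.

End GramLowerTail.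

(** * Likelihood ratios *)

Section Likelihood.
Variables (R : realType) (m n L : nat) (sw : R).
Hypothesis sw0 : 0 < sw.
Local Notation I := ('I_m * 'I_n + 'I_L * 'I_n)%type.
Local Notation A := (@Amx R m n ('I_L * 'I_n)%type).
Local Notation noise := (@noise R m n L sw).

Definition sqv (x : 'rV[R]_n) : 'rV[R]_n := \row_i x 0 i ^+ 2.

Definition Sig (x : 'rV[R]_n) (v : fvec R I) : 'M[R]_m := A v *m diag_mx (sqv x) *m (A v)^T.

Definition data (xo : 'rV[R]_n) l (v : fvec R I) : 'cV[R]_m := A v *m diag_mx xo *m noise l v.

Definition quad xo x v : R :=
  \sum_l dot (data xo l v) (adjinv (Sig x v) *m data xo l v).

Definition loss xo x v : R := ln (\det (Sig x v)) + L%:R^-1 * quad xo x v.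

(** Four times the Bhattacharyya distance between the centred Gaussians with covariances [Sig x v]
    and [Sig xo v]. *)
Definition bhatt xo x v : R :=
  2 * ln (\det (2^-1 *: (Sig x v + Sig xo v))) - ln (\det (Sig x v)) - ln (\det (Sig xo v)).

Definition fullrank : set (fvec R I) := [set v | \det (A v *m (A v)^T) <> 0].

Lemma mxmeas_Sig x : mxmeas (Sig x).
Proof.
have mA : mxmeas A by exact: mxmeas_Amx.
apply: mxmeasM; last exact: mxmeas_tr.
by apply: mxmeasM => //; exact: mxmeas_cst.
Qed.

Lemma mxmeas_data xo l : mxmeas (data xo l).
Proof.
apply: mxmeasM; last exact: mxmeas_noise.
by apply: mxmeasM; [exact: mxmeas_Amx|exact: mxmeas_cst].
Qed.

Lemma measurable_ln_det (M : fvec R I -> 'M[R]_m) :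
  mxmeas M -> measurable_fun setT (fun v => ln (\det (M v))).
Proof. by move=> mM; exact: (measurableT_comp (@measurable_ln R) (measurable_det mM)). Qed.

Lemma measurable_loss xo x : measurable_fun setT (loss xo x).
Proof.
apply: measurable_funD; first by apply: measurable_ln_det; exact: mxmeas_Sig.
apply: measurable_funM => //; apply: measurable_sum => l.
apply: measurable_dot; first exact: mxmeas_data.
apply: mxmeasM; last exact: mxmeas_data.
by apply: mxmeas_adjinv; exact: mxmeas_Sig.
Qed.

Lemma measurable_bhatt xo x : measurable_fun setT (bhatt xo x).
Proof.
apply: measurable_funB; last by apply: measurable_ln_det; exact: mxmeas_Sig.
apply: measurable_funB; last by apply: measurable_ln_det; exact: mxmeas_Sig.
apply: measurable_funM => //; apply: measurable_ln_det; apply: mxmeasZ => //.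
by apply: mxmeasD; exact: mxmeas_Sig.
Qed.

Lemma measurable_fullrank : measurable fullrank.
Proof.
apply: measurableC; apply: measurable_eq0; apply: measurable_det.
by apply: mxmeasM; [|apply: mxmeas_tr]; exact: mxmeas_Amx.
Qed.

Lemma posdef_Sig (x : 'rV[R]_n) v : fullrank v -> (forall i, 0 < x 0 i) -> posdef (Sig x v).
Proof.
by move=> fr x0; apply: posdef_sandwich => // i; rewrite mxE exprn_gt0.
Qed.

Lemma Sig_gram x v : Sig x v = (A v *m diag_mx x) *m (A v *m diag_mx x)^T.
Proof.
rewrite trmx_mul tr_diag_mx mulmxA -(mulmxA (A v)) mulmx_diag /Sig.
by congr (_ *m diag_mx _ *m _); apply/rowP => i; rewrite !mxE expr2.
Qed.

Lemma dot_Sig x v u : dot u (Sig x v *m u) = \sum_i x 0 i ^+ 2 * ((A v)^T *m u) i 0 ^+ 2.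
Proof.
rewrite -!mulmxA dot_mulr dot_diag; apply: eq_bigr => i _.
by rewrite [sqv _ _ _]mxE.
Qed.

Section Tail.
Variable mu : probability (fvec R I) R.
Hypothesis muE : forall B : I -> set R, (forall i, measurable (B i)) ->
  mu [set v | forall i, B i (v i)] = (\prod_i model_law sw i (B i))%E.

Definition loss_bad xo x t : set (fvec R I) := fullrank `&`
  [set v | t < L%:R / 4 * (loss xo xo v - loss xo x v + bhatt xo x v)].

(** With $B=AX_o$, the Chernoff matrix is $1+\frac12 B^\top(\Sigma_x^{-1}-\Sigma_o^{-1})B$. It is
    positive definite because $B^\top\Sigma_o^{-1}B$ is a projection, so that at least half the
    identity remains. *)
Lemma loss_tail (xo x : 'rV[R]_n) t : (0 < L)%N -> (forall i, 0 < x 0 i) -> (forall i, 0 < xo 0 i) ->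
  measurable (loss_bad xo x t) /\ (mu (loss_bad xo x t) <= (expR (- t))%:E)%E.
Proof.
move=> L0 x0 xo0; have LR : L%:R != 0 :> R by rewrite pnatr_eq0 -lt0n.
have mQ : measurable (loss_bad xo x t).
  apply: measurableI; first exact: measurable_fullrank.
  apply: (@measurable_gt_set R _ (fvec R I)
    (fun v => L%:R / 4 * (loss xo xo v - loss xo x v + bhatt xo x v))).
  apply: measurable_funM => //; apply: measurable_funD; last exact: measurable_bhatt.
  by apply: measurable_funB; exact: measurable_loss.
split=> //.
pose B v := A v *m diag_mx xo.
pose M v := adjinv (Sig x v) - adjinv (Sig xo v).
pose S v : 'M[R]_n := 1%:M + 2^-1 *: ((B v)^T *m M v *m B v).
have mB : mxmeas B by apply: mxmeasM; [exact: mxmeas_Amx|exact: mxmeas_cst].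
have mS : mxmeas S.
  apply: mxmeasD; first exact: mxmeas_cst.
  apply: mxmeasZ => //; apply: mxmeasM => //; apply: mxmeasM; first exact: mxmeas_tr.
  by apply: mxmeasB; apply: mxmeas_adjinv; exact: mxmeas_Sig.
have qS v u : dot u (S v *m u) = dot u u + 2^-1 *
    (dot (B v *m u) (adjinv (Sig x v) *m (B v *m u)) -
     dot (B v *m u) (adjinv (Sig xo v) *m (B v *m u))).
  rewrite /S mulmxDl mul1mx dotDr -scalemxAl dotZr -(mulmxA ((B v)^T *m M v)).
  by rewrite -(mulmxA (B v)^T) (dot_mulr (B v)^T) trmxK /M mulmxBl dotBr.
have pS v : fullrank v -> posdef (S v).
  move=> fr; have px := posdef_Sig fr x0; have po := posdef_Sig fr xo0.
  have [sx _] := posdef_inv px; have [so _] := posdef_inv po.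
  split=> [|u u0].
    have sM : (M v)^T = M v.
      by rewrite /M linearB /= (adjinvE (posdef_unit px)) (adjinvE (posdef_unit po)) sx so.
    rewrite /S linearD linearZ /= trmx1 (trmx_mul _ (B v)) (trmx_mul _ (M v)).
    by rewrite trmxK sM mulmxA.
  rewrite qS (adjinvE (posdef_unit px)) (adjinvE (posdef_unit po)).
  have h1 := posdef_ge0 (B v *m u) (posdef_inv px).
  have h2 : dot (B v *m u) (invmx (Sig xo v) *m (B v *m u)) <= dot u u.
    by rewrite Sig_gram; apply: dot_projection; rewrite -Sig_gram.
  have := dot_gt0 u0; lra.
have iinj (l l' : 'I_L) (j j' : 'I_n) : inr (l, j) = inr (l', j') :> I -> l = l' /\ j = j'.
  by move=> [-> ->].
have ml (l : 'I_L) (j : 'I_n) : model_law sw (inr (l, j) : I) = gauss sw :> probability R R by [].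
apply: (@gauss_chernoff _ _ _ _ muE _ _ (fun (l : 'I_L) j => inr (l, j)) sw sw0 iinj ml
  fullrank S measurable_fullrank mS pS (enum 'I_L) t) => //.
- exact: enum_uniq.
- move=> v v' vv'; have EA : A v = A v' by apply/matrixP => i j; rewrite !mxE vv'.
  by rewrite /S /M /B /Sig /fullrank /= EA.
move=> v [fr /= h]; split=> //; move: h.
have px := posdef_Sig fr x0; have po := posdef_Sig fr xo0.
have ux := posdef_unit px; have uo := posdef_unit po.
rewrite big_enum /= -cardE card_ord.
(* As $BB^\top=\Sigma_o$, Sylvester's identity moves the determinant from size [n] to size [m],
   where it is $\det(K\Sigma_x^{-1})$ with $K$ the mean of the two covariances. *)
have dS : \det (S v) = \det (2^-1 *: (Sig x v + Sig xo v)) / \det (Sig x v).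
  rewrite /S -mulmxA scalemxAr det_1D_mulC -scalemxAl -mulmxA -Sig_gram.
  rewrite mulrC -det_inv -det_mulmx; congr (\det _).
  rewrite /M (adjinvE ux) (adjinvE uo) mulmxBl mulVmx // -scalemxAr mulmxDr mulVmx //.
  by apply/matrixP => i j; rewrite !mxE; field.
have pK : posdef (2^-1 *: (Sig x v + Sig xo v)) by apply: posdefZ; [lra|exact: posdefD].
rewrite dS ln_div ?posrE ?posdef_det_gt0 //.
have -> : \sum_l dot (block (fun (l : 'I_L) j => inr (l, j) : I) sw l v)
    ((S v - 1%:M) *m block (fun (l : 'I_L) j => inr (l, j) : I) sw l v) =
    2^-1 * (quad xo x v - quad xo xo v).
  rewrite /quad -sumrB mulr_sumr; apply: eq_bigr => l _.
  by rewrite mulmxBl mul1mx dotBr qS addrC addKr.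
rewrite /loss /bhatt; move: (ln _) (ln _) (ln _) (quad _ _ _) (quad _ _ _) => a b c e f.
congr (_ < _); field; exact: LR.
Qed.

End Tail.

Lemma bhatt_ge (xo x : 'rV[R]_n) v b : (0 < m)%N -> (0 < n)%N -> 0 < b -> (forall i, 0 < x 0 i <= b) ->
  (forall i, 0 < xo 0 i <= b) -> fullrank v -> ~ opnorm_bad v ->
  frob (A v *m diag_mx (\row_i ((xo 0 i ^+ 2 - x 0 i ^+ 2) / 2)) *m (A v)^T) /
    (b ^+ 2 * (120 * n%:R)) ^+ 2 <= bhatt xo x v.
Proof.
move=> m0 n0 b0 xb xob fr nop.
have op := opnorm_good m0 nop.
have x0 i : 0 < x 0 i by case/andP: (xb i).
have xo0 i : 0 < xo 0 i by case/andP: (xob i).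
set D := A v *m _ *m _; set K := 2^-1 *: (Sig x v + Sig xo v).
have ED : D = 2^-1 *: (Sig xo v - Sig x v).
  rewrite /D /Sig -mulmxBl -mulmxBr -linearB /= scalemxAl scalemxAr -linearZ /=.
  by congr (_ *m diag_mx _ *m _); apply/rowP => i; rewrite !mxE mulrC.
have Em : K - D = Sig x v by rewrite ED; apply/matrixP => i j; rewrite !mxE; field.
have Ep : K + D = Sig xo v by rewrite ED; apply/matrixP => i j; rewrite !mxE; field.
rewrite /bhatt -/K -Em -Ep; apply: bhattacharyya_ge.
- by rewrite !mulr_gt0 ?exprn_gt0 ?ltr0n.
- by rewrite Em; exact: posdef_Sig.
- by rewrite Ep; exact: posdef_Sig.
move=> u; rewrite -scalemxAl dotZr mulmxDl dotDr !dot_Sig -big_split /= mulr_sumr.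
apply: (@le_trans _ _ (\sum_i b ^+ 2 * ((A v)^T *m u) i 0 ^+ 2)).
  apply: ler_sum => i _; rewrite -mulrDl mulrA ler_wpM2r ?sqr_ge0 //.
  have /andP[h1 h2] := xb i; have /andP[h3 h4] := xob i; nra.
rewrite -mulr_sumr -mulrA ler_wpM2l ?sqr_ge0 //; apply: le_trans (op u).
by rewrite dotE; apply: ler_sum => i _; rewrite expr2.
Qed.

(** The covariances at [x] and [xh] agree as forms up to the factor $1+e$. The log determinant thus
    grows by at most $m\ln(1+e)\le me$ and the quadratic term by at most $e$ times its value at
    [xh]. *)
Lemma loss_approx (xo x xh : 'rV[R]_n) v a b e : 0 < a -> 0 < b -> 0 < e -> (forall i, a <= x 0 i) ->
  (forall i, a <= xh 0 i) -> (forall i, 0 <= xo 0 i <= b) -> fullrank v ->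
  (forall i, xh 0 i ^+ 2 <= (1 + e) * x 0 i ^+ 2) ->
  (forall i, x 0 i ^+ 2 <= (1 + e) * xh 0 i ^+ 2) ->
  loss xo x v <= loss xo xh v + m%:R * e +
    e * (b / a) ^+ 2 * (L%:R^-1 * \sum_l dot (noise l v) (noise l v)).
Proof.
move=> a0 b0 e0 xa xha xob fr h1 h2.
have x0 i : 0 < x 0 i by apply: lt_le_trans (xa i).
have xh0 i : 0 < xh 0 i by apply: lt_le_trans (xha i).
have px := posdef_Sig fr x0; have ph := posdef_Sig fr xh0.
have c0 : 0 < 1 + e by rewrite addr_gt0.
have hdet : ln (\det (Sig x v)) <= ln (\det (Sig xh v)) + m%:R * e.
  have le : \det (Sig x v) <= \det ((1 + e) *: Sig xh v).
    apply: le_det => //; first exact: posdefZ.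
    move=> u; rewrite -scalemxAl dotZr !dot_Sig mulr_sumr; apply: ler_sum => i _.
    by rewrite [leRHS]mulrA ler_wpM2r ?sqr_ge0.
  apply: le_trans (_ : ln (\det ((1 + e) *: Sig xh v)) <= _).
    by rewrite ler_ln // posrE ?detZ ?mulr_gt0 ?exprn_gt0 ?posdef_det_gt0.
  rewrite detZ lnM ?posrE ?exprn_gt0 ?posdef_det_gt0 // lnXn // [leLHS]addrC lerD2l.
  by rewrite -[ln _ *+ m]mulr_natl ler_wpM2l // le_ln1Dx // (lt_trans _ e0) // oppr_lt0.
have hq l : dot (data xo l v) (invmx (Sig xh v) *m data xo l v) <=
    (b / a) ^+ 2 * dot (noise l v) (noise l v).
  (* Written as $AX_h$ applied to the rescaled noise, the data are whitened by the covariance at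
     [xh], and [dot_projection] applies; the rescaling is at most $b/a$. *)
  have -> : data xo l v = (A v *m diag_mx xh) *m
      (diag_mx (\row_i (xo 0 i / xh 0 i)) *m noise l v).
    rewrite /data !mulmxA -(mulmxA (A v) (diag_mx xh)) mulmx_diag.
    congr (_ *m diag_mx _ *m _); apply/rowP => i; rewrite !mxE mulrC divfK //.
    by rewrite gt_eqF.
  rewrite Sig_gram; apply: le_trans (dot_projection _ _) _; first by rewrite -Sig_gram.
  apply: dot_diag_le => i; rewrite mxE; have /andP[h3 h4] := xob i.
  rewrite ger0_norm ?divr_ge0 ?(ltW (xh0 i)) //.
  by apply: ler_pM; rewrite ?invr_ge0 ?(ltW (xh0 i)) // lef_pV2 ?posrE.
have hqx : quad xo x v <= (1 + e) * quad xo xh v.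
  rewrite /quad mulr_sumr; apply: ler_sum => l _.
  rewrite (adjinvE (posdef_unit px)) (adjinvE (posdef_unit ph)).
  apply: le_dot_invmx => // u; rewrite !dot_Sig mulr_sumr; apply: ler_sum => i _.
  by rewrite [leRHS]mulrA ler_wpM2r ?sqr_ge0.
have hq3 : quad xo xh v <= (b / a) ^+ 2 * \sum_l dot (noise l v) (noise l v).
  rewrite /quad mulr_sumr (adjinvE (posdef_unit ph)); apply: ler_sum => l _; exact: hq.
have Li : 0 <= L%:R^-1 :> R by rewrite invr_ge0.
have h5 : L%:R^-1 * quad xo x v <= L%:R^-1 * ((1 + e) * quad xo xh v) by rewrite ler_wpM2l.
have h6 : L%:R^-1 * e * quad xo xh v <=
    L%:R^-1 * e * ((b / a) ^+ 2 * \sum_l dot (noise l v) (noise l v)).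
  by rewrite ler_wpM2l // mulr_ge0 // ltW.
rewrite /loss; move: h5 h6 hdet; set s := \sum_l _; set r := (b / a) ^+ 2; lra.
Qed.

End Likelihood.

(** * Recovery *)

Section ThetaNet.
Variable R : realType.

Lemma l2norm_sqr n (v : 'rV[R]_n) : l2norm v ^+ 2 = \sum_i v 0 i ^+ 2.
Proof. by rewrite sqr_sqrtr // sumr_ge0 // => i _; rewrite sqr_ge0. Qed.

Lemma l2norm_coord n (v : 'rV[R]_n) i : `|v 0 i| <= l2norm v.
Proof.
rewrite -sqrtr_sqr ler_wsqrtr // (bigD1 i) //= lerDl.
by apply: sumr_ge0 => j _; rewrite sqr_ge0.
Qed.

Lemma l2norm_le n (v : 'rV[R]_n) c : 0 <= c -> (forall i, n%:R * `|v 0 i| ^+ 2 <= c ^+ 2) ->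
  l2norm v <= c.
Proof.
move=> c0 vc; rewrite -(ger0_norm c0) -sqrtr_sqr ler_wsqrtr //.
case: n v vc => [|n] v vc; first by rewrite big_ord0 sqr_ge0.
rewrite -(@ler_pM2l _ n.+1%:R) // mulr_sumr.
apply: (@le_trans _ _ (\sum_(i < n.+1) c ^+ 2)).
  by apply: ler_sum => i _; have := vc i; rewrite real_normK ?num_real.
by rewrite sumr_const card_ord mulr_natl.
Qed.

(** Parameters are sorted into cubes of side $\delta/\sqrt k$, whose diameter is $\delta$; the
    Lipschitz bound carries this to the image. *)
Lemma lipschitz_net n k r delta (g : 'rV[R]_k -> 'rV[R]_n) (C : set 'rV[R]_n) xo N :
  0 < delta -> 2 * r * Num.sqrt k%:R / delta <= N%:R ->
  (forall th1 th2, l2ball k r th1 -> l2ball k r th2 ->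
     l2norm (g th1 - g th2) <= l2norm (th1 - th2)) ->
  C `<=` g @` l2ball k r -> C xo ->
  exists xnet : {ffun 'I_k -> 'I_N.+1} -> 'rV[R]_n,
    (forall c, C (xnet c)) /\ (forall x, C x -> exists c, l2norm (x - xnet c) <= delta).
Proof.
move=> d0 Nr lip Cg Cxo.
pose h := Num.sqrt k%:R / delta.
have h0 : 0 <= h by rewrite divr_ge0 // ltW.
pose cell (th : 'rV[R]_k) := [ffun i => inord (Num.truncn ((th 0 i + r) * h)) : 'I_N.+1].
(* The representative of a cube is an image lying in [C], so the net stays in [C]; cubes without
   such a parameter receive [xo]. *)
have P c : exists x, C x /\ ((exists th, [/\ l2ball k r th, C (g th) & cell th = c]) ->
    exists2 th, l2ball k r th /\ cell th = c & x = g th).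
  have [[th [h1 h2 h3]]|nth] := pselect (exists th, [/\ l2ball k r th, C (g th) & cell th = c]).
    by exists (g th); split=> // _; exists th.
  by exists xo; split=> // /nth.
pose xnet := [ffun c => sval (cid (P c))].
exists xnet; split=> [c|x Cx].
  by rewrite ffunE; case: cid => x [].
have [th bth gth] := Cg x Cx; exists (cell th).
rewrite ffunE; case: cid => y [Cy] /= H.
have [th' [bth' eth] ->] := H (ex_intro _ th (And3 bth (eq_ind_r C Cx gth) erefl)).
rewrite -gth; apply: le_trans (lip _ _ bth bth') _.
apply: l2norm_le; first exact: ltW.
move=> i.
have bound (u : 'rV[R]_k) : l2ball k r u -> 0 <= (u 0 i + r) * h <= N%:R.
  rewrite /l2ball /= => bu; have := le_trans (l2norm_coord u i) bu.
  rewrite ler_norml => /andP[l1 l2]; apply/andP; split.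
    by rewrite mulr_ge0 // -lerBlDr sub0r.
  apply: le_trans Nr; rewrite -mulrA -/h ler_wpM2r //; lra.
have tr (u : 'rV[R]_k) : l2ball k r u -> cell u i = Num.truncn ((u 0 i + r) * h) :> nat.
  move=> /bound/andP[b1 b2]; rewrite ffunE inordK // ltnS.
  by rewrite -(ler_nat R); apply: le_trans b2; rewrite truncn_le.
have /andP[b1 b2] := bound _ bth; have /andP[b1' b2'] := bound _ bth'.
have /andP[t1 t2] := truncn_itv b1; have /andP[t1' t2'] := truncn_itv b1'.
have E : Num.truncn ((th 0 i + r) * h) = Num.truncn ((th' 0 i + r) * h).
  by rewrite -!tr // eth.
rewrite E -natr1 in t1 t2; rewrite -natr1 in t2'.
have hd : `|(th - th') 0 i| * h <= 1.
  rewrite -[X in _ * X](ger0_norm h0) -normrM !mxE ler_norml; apply/andP; split; lra.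
have : (`|(th - th') 0 i| * h) ^+ 2 <= 1 by rewrite expr_le1 // mulr_ge0.
rewrite exprMn /h expr_div_n sqr_sqrtr // mulrA ler_pdivrMr ?exprn_gt0 // mul1r.
by rewrite mulrC.
Qed.

End ThetaNet.

Section NegLogLikelihood.
Variables (R : realType) (m n L : nat) (sw : R).
Hypothesis sw0 : 0 < sw.
Local Notation I := ('I_m * 'I_n + 'I_L * 'I_n)%type.

(** The scale [sw] cancels from the quadratic term and adds to the log determinant a constant
    independent of [x], so comparisons of losses are unaffected. *)
Lemma speckle_nllE (xo x : 'rV[R]_n) (v : fvec R I) : fullrank v -> (forall i, 0 < x 0 i) ->
  speckle_nll sw (Amx v) (fun l => Amx v *m diag_mx xo *m \col_i v (inr (l, i))) x =
  ln ((sw ^+ 2) ^+ m) + loss sw xo x v.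
Proof.
move=> fr x0; have pS := posdef_Sig fr x0; have uS := posdef_unit pS.
rewrite /speckle_nll /=.
have -> : Amx v *m (diag_mx x *m diag_mx x) *m (Amx v)^T = Sig x v.
  rewrite mulmx_diag /Sig; have -> // : sqv x = \row_j (x 0 j * x 0 j).
  by apply/rowP => i; rewrite !mxE expr2.
have s2 : 0 < sw ^+ 2 by rewrite exprn_gt0.
rewrite detZ lnM ?posrE ?exprn_gt0 ?posdef_det_gt0 // -addrA /loss; congr (_ + (_ + _ * _)).
rewrite /quad (adjinvE uS); apply: eq_bigr => l _.
rewrite invmxZ ?unitmxZ ?unitfE ?gt_eqF //.
have -> : \col_i v (inr (l, i)) = sw *: noise sw l v.
  by apply/colP => i; rewrite !mxE mulrC divfK // gt_eqF.
have -> : Amx v *m diag_mx xo *m (sw *: noise sw l v) = sw *: data sw xo l v.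
  by rewrite -scalemxAr.
transitivity (dot (sw *: data sw xo l v) ((sw ^+ 2)^-1 *: invmx (Sig x v) *m (sw *: data sw xo l v))).
  by rewrite /dot mulmxA.
rewrite -scalemxAl -scalemxAr !(dotZl, dotZr); field; exact: lt0r_neq0.
Qed.

End NegLogLikelihood.

Section Constants.
Variable R : realType.

(** For $n\ge2$ this is an exponent $p$ with $4(b/a)n^3\le n^p$; the left side bounds the number of
    cubes per axis. *)
Definition net_exponent (a b : R) : R := 3 + ln (4 * (b / a)) / ln 2.

(** Numerator of the discretisation error: relative change $3/n^2$, times $n$ for the log
    determinant and $6n(b/a)^2$ for the noise energy. *)
Definition approx_const (a b : R) : R := 3 * (1 + 6 * (b / a) ^+ 2).

Definition error_const (a b : R) : R :=
  let c := net_exponent a b + 1 in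
  4 * a ^+ 2 + b ^+ 4 / a ^+ 2 *
    (12 * 363 * Num.sqrt c + 48 * (120 * 120) * c + 24 * (120 * 120) * approx_const a b).

Lemma ln2_ge : 2^-1 <= ln 2 :> R.
Proof.
have := @le_ln1Dx R (- 2^-1); have -> : 1 + - 2^-1 = 2^-1 :> R by lra.
by rewrite lnV ?posrE // lerN2; apply; lra.
Qed.

Lemma net_exponent_ge3 a b : 0 < a -> a <= b -> 3 <= net_exponent a b.
Proof.
move=> a0 ab; rewrite /net_exponent lerDl divr_ge0 //; last by have := ln2_ge; lra.
have : 1 <= b / a by rewrite ler_pdivlMr // mul1r.
by move=> h; rewrite ln_ge0 //; lra.
Qed.

Lemma error_const_gt0 a b : 0 < a -> a <= b -> 0 < error_const a b.
Proof.
move=> a0 ab; have c3 := net_exponent_ge3 a0 ab.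
have a2 : 0 < a ^+ 2 by rewrite exprn_gt0.
have K0 : 0 <= approx_const a b by rewrite mulr_ge0 // addr_ge0 // mulr_ge0 // sqr_ge0.
have s0 := sqrtr_ge0 (net_exponent a b + 1).
rewrite /error_const; apply: ltr_pwDl; first by rewrite mulr_gt0.
apply: mulr_ge0; first by rewrite divr_ge0 ?(ltW a2) // exprn_even_ge0.
lra.
Qed.

(** The bookkeeping, with [T2] for $|D|^2$ and [Z], [Y], [W] for the squared distances net point to
    truth, estimate to net point, estimate to truth. *)
Lemma error_arith (a b m n L kl T2 Z Y W F : R) :
  let c := net_exponent a b + 1 in let K := approx_const a b in
  0 < a -> a <= b -> 1 <= m -> m <= n -> 0 < L -> 4^-1 <= kl ->
  a ^+ 2 * Z <= T2 ->
  m ^+ 2 / 6 * T2 - 363 * (b ^+ 2) ^+ 2 * m * n * Num.sqrt (c * kl) <= F ->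
  F <= (b ^+ 2 * (120 * n)) ^+ 2 * (4 * (c * kl) / L + K / n) ->
  Y <= (a / n ^+ 2) ^+ 2 -> W <= 2 * Y + 2 * Z ->
  n^-1 * W <= error_const a b * (n / m ^+ 2 * (kl / L) + Num.sqrt kl / m).
Proof.
move=> c K a0 ab m1 mn L0 kl4 hZ h2 h3 hY hW.
have b0 : 0 < b by apply: lt_le_trans ab.
have m0 : 0 < m by lra.
have n0 : 0 < n by lra.
have c3 := net_exponent_ge3 a0 ab.
have c0 : 0 < c by rewrite /c; lra.
have K0 : 0 <= K by rewrite mulr_ge0 // addr_ge0 // mulr_ge0 // sqr_ge0.
set S := Num.sqrt kl / m; set U := n / m ^+ 2 * (kl / L).
have kl0 : 0 <= kl by lra.
have sk : 2^-1 <= Num.sqrt kl.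
  have e : (2^-1) ^+ 2 = 4^-1 :> R by field.
  by rewrite -(@ger0_norm _ (2^-1 : R)) // -sqrtr_sqr e ler_wsqrtr.
(* Since $\sqrt{kl}\ge 1/2$, every error of order $1/m$, including those of the net, is absorbed
   into the second term of the bound. *)
have S1 : m^-1 <= 2 * S.
  rewrite /S mulrA -[leLHS]mul1r ler_wpM2r ?invr_ge0 ?(ltW m0) //; lra.
have S0 : 0 <= S by rewrite divr_ge0 ?sqrtr_ge0 // ltW.
have U0 : 0 <= U by rewrite !mulr_ge0 ?invr_ge0 ?sqr_ge0 // ltW.
have mi1 : m^-1 <= 1 by rewrite invf_le1.
have mi0 : 0 < m^-1 by rewrite invr_gt0.
have ni1 : n^-1 <= m^-1 by rewrite lef_pV2.
have ni0 : 0 < n^-1 by rewrite invr_gt0.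
have hT : n^-1 * T2 <= b ^+ 4 * (6 * 363 * Num.sqrt c * S + 24 * (120 * 120) * c * U + 6 * (120 * 120) * K * m^-1 ^+ 2).
  have : m ^+ 2 / 6 * T2 <= 363 * (b ^+ 2) ^+ 2 * m * n * Num.sqrt (c * kl) +
     (b ^+ 2 * (120 * n)) ^+ 2 * (4 * (c * kl) / L + K / n) by lra.
  have p6 : 0 <= 6 * m^-1 ^+ 2 * n^-1 by rewrite !mulr_ge0 ?sqr_ge0 // ltW.
  move=> /(ler_wpM2l p6).
  have -> : 6 * m^-1 ^+ 2 * n^-1 * (m ^+ 2 / 6 * T2) = n^-1 * T2 by field; rewrite !gt_eqF.
  move=> h; apply: le_trans h _; rewrite sqrtrM ?(ltW c0) // le_eqVlt; apply/orP; left.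
  by apply/eqP; rewrite /S /U; field; rewrite !gt_eqF.
have hZn : n^-1 * Z <= n^-1 * T2 / a ^+ 2.
  by rewrite ler_pdivlMr ?exprn_gt0 // mulrC mulrCA ler_pM2l.
have a2 : 0 < a ^+ 2 by rewrite exprn_gt0.
have hZn2 : n^-1 * Z <= b ^+ 4 / a ^+ 2 *
    (6 * 363 * Num.sqrt c * S + 24 * (120 * 120) * c * U + 6 * (120 * 120) * K * m^-1 ^+ 2).
  apply: le_trans hZn _; rewrite ler_pdivrMr // mulrAC divfK ?gt_eqF //.
have hKm : K * m^-1 ^+ 2 <= K * (2 * S) by rewrite ler_wpM2l //; nra.
have hYn : n^-1 * Y <= a ^+ 2 * (2 * S).
  apply: (@le_trans _ _ (n^-1 * (a / n ^+ 2) ^+ 2)); first by rewrite ler_pM2l.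
  have -> : n^-1 * (a / n ^+ 2) ^+ 2 = a ^+ 2 * n^-1 ^+ 5 by field; rewrite gt_eqF.
  rewrite ler_pM2l //; apply: le_trans (_ : n^-1 <= _); last by lra.
  by rewrite exprS ler_piMr ?(ltW ni0) // exprn_ile1 ?(ltW ni0) //; lra.
have hB : 0 <= b ^+ 4 / a ^+ 2 by rewrite divr_ge0 ?(ltW a2) // exprn_even_ge0.
have hbig : b ^+ 4 / a ^+ 2 * (6 * 363 * Num.sqrt c * S + 24 * (120 * 120) * c * U + 6 * (120 * 120) * K * m^-1 ^+ 2)
  <= b ^+ 4 / a ^+ 2 * (6 * 363 * Num.sqrt c * S + 24 * (120 * 120) * c * U + 12 * (120 * 120) * K * S).
  by rewrite ler_wpM2l //; lra.
have hWn : n^-1 * W <= 2 * (n^-1 * Y) + 2 * (n^-1 * Z).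
  by rewrite mulrCA [X in _ + X]mulrCA -mulrDr ler_pM2l.
have hc : 0 <= Num.sqrt c by rewrite sqrtr_ge0.
rewrite /error_const -/c -/K.
apply: (@le_trans _ _ (4 * a ^+ 2 * S + b ^+ 4 / a ^+ 2 *
    (12 * 363 * Num.sqrt c * S + 48 * (120 * 120) * c * U + 24 * (120 * 120) * K * S))); first by lra.
rewrite [leRHS]mulrDl; apply: lerD.
  by apply: ler_wpM2l; [rewrite mulr_ge0 // ltW|lra].
rewrite -[leRHS]mulrA; apply: ler_wpM2l => //.
have := mulr_ge0 hc U0; have := mulr_ge0 (ltW c0) S0; have := mulr_ge0 K0 U0; lra.
Qed.

End Constants.

Section Elementary.
Variable R : realType.

Lemma half_sqr_diff_ge (a y z : R) : 0 < a -> a <= y -> a <= z ->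
  a ^+ 2 * (y - z) ^+ 2 <= ((z ^+ 2 - y ^+ 2) / 2) ^+ 2.
Proof.
move=> a0 ay az.
have -> : ((z ^+ 2 - y ^+ 2) / 2) ^+ 2 = ((y + z) / 2) ^+ 2 * (y - z) ^+ 2 by field.
by rewrite ler_wpM2r ?sqr_ge0 // lerXn2r // ?nnegrE; lra.
Qed.

Lemma sqr_close (a y z u : R) : 0 < a -> a <= y -> a <= z -> 0 < u -> u <= 1 ->
  `|y - z| <= a * u -> y ^+ 2 <= (1 + 3 * u) * z ^+ 2.
Proof.
move=> a0 ay az u0 u1; rewrite ler_norml => /andP[_ h].
have h2 : y <= (1 + u) * z.
  have : a * u <= u * z by rewrite mulrC ler_pM2l.
  by lra.
have : y ^+ 2 <= ((1 + u) * z) ^+ 2 by rewrite lerXn2r // nnegrE; nra.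
move/le_trans; apply; rewrite exprMn ler_wpM2r ?sqr_ge0 //; nra.
Qed.

Lemma abs_half_sqr_diff_le (b y z : R) : 0 < y <= b -> 0 < z <= b ->
  `|(y ^+ 2 - z ^+ 2) / 2| <= b ^+ 2.
Proof.
move=> /andP[h1 h2] /andP[h3 h4]; rewrite ler_norml; apply/andP; split; nra.
Qed.

Lemma le_of_scaled_le (l t s lo lx u : R) : 0 < l -> l / 4 * (lo - lx + u) <= t ->
  lx <= lo + s -> u <= 4 * t / l + s.
Proof.
move=> l0 h1 h2.
have : lo - lx + u <= 4 * t / l by rewrite ler_pdivlMr //; lra.
by lra.
Qed.

Lemma sqr_sub_le (x y z : R) : (x - z) ^+ 2 <= 2 * (x - y) ^+ 2 + 2 * (y - z) ^+ 2.
Proof. by rewrite -subr_ge0; have := sqr_ge0 (x - y - (y - z)); nra. Qed.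

End Elementary.

Section Recovery.
Variables (R : realType) (m n k L : nat) (sw a b : R).
Local Notation I := ('I_m * 'I_n + 'I_L * 'I_n)%type.
Variable mu : probability (fvec R I) R.
Hypothesis muE : forall B : I -> set R, (forall i, measurable (B i)) ->
  mu [set v | forall i, B i (v i)] = (\prod_i model_law sw i (B i))%E.
Hypotheses (m2 : (2 <= m)%N) (mn : (m <= n)%N) (L1 : (0 < L)%N) (k1 : (0 < k)%N).
Hypotheses (sw0 : 0 < sw) (a0 : 0 < a) (ab : a <= b).
Variables (xo : 'rV[R]_n) (g : 'rV[R]_k -> 'rV[R]_n) (C : set 'rV[R]_n).
Local Notation radius := (b * Num.sqrt (n%:R / k%:R)).
Hypothesis lip : forall th1 th2, l2ball k radius th1 -> l2ball k radius th2 ->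
  l2norm (g th1 - g th2) <= l2norm (th1 - th2).
Hypothesis Cg : C `<=` g @` l2ball k radius.
Hypothesis Cxo : C xo.
Hypothesis Cab : forall x, C x -> forall i, a <= x 0 i <= b.

Let kl : R := k%:R * ln n%:R.
(** Relative to entries of size at least [a] this is $n^{-2}$, so squared entries change by a factor
    at most $1+3/n^2$. *)
Let delta : R := a / n%:R ^+ 2.
Let t : R := (net_exponent a b + 1) * kl.

Let b0 : 0 < b. Proof. exact: lt_le_trans ab. Qed.
Let n2 : (2 <= n)%N. Proof. exact: leq_trans mn. Qed.
Let nR : 0 < n%:R :> R. Proof. by rewrite ltr0n (leq_trans _ n2). Qed.
Let ratio1 : 1 <= b / a. Proof. by rewrite ler_pdivlMr // mul1r. Qed.

Let lnn : ln 2 <= ln n%:R :> R.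
Proof. by rewrite ler_ln ?posrE // ler_nat. Qed.

Let kl_ge : 2^-1 <= kl.
Proof.
have h := le_trans (ln2_ge R) lnn.
have k1R : 1 <= k%:R :> R by rewrite ler1n.
by rewrite /kl -[leLHS]mul1r ler_pM.
Qed.

Let t0 : 0 < t.
Proof. by rewrite mulr_gt0 //; [have := net_exponent_ge3 a0 ab|have := kl_ge]; lra. Qed.

(* The cubes of the net have side [delta / sqrt k] in a cube of side [2 * radius]. *)
Lemma exists_net : exists (N : nat) (xnet : {ffun 'I_k -> 'I_N.+1} -> 'rV[R]_n),
  [/\ forall c, C (xnet c), forall x, C x -> exists c, l2norm (x - xnet c) <= delta &
      N.+1%:R ^+ k <= expR (net_exponent a b * kl)].
Proof.
have d0 : 0 < delta by rewrite divr_gt0 // exprn_gt0.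
pose q : R := 2 * (b / a) * n%:R ^+ 3.
have q0 : 0 <= q by rewrite !mulr_ge0 ?exprn_ge0 ?invr_ge0 // ltW.
pose N := (Num.truncn q).+1.
have Nr : 2 * radius * Num.sqrt k%:R / delta <= N%:R.
  have -> : 2 * radius * Num.sqrt k%:R / delta = 2 * (b / a) * (n%:R ^+ 2 * Num.sqrt n%:R).
    have -> : Num.sqrt n%:R = Num.sqrt (n%:R / k%:R) * Num.sqrt k%:R :> R.
      by rewrite -sqrtrM ?divfK ?divr_ge0 // pnatr_eq0 -lt0n.
    by rewrite /delta; field; rewrite !gt_eqF.
  apply: (@le_trans _ _ q); last by rewrite ltW // real_truncnS_gt // num_real.
  rewrite /q ler_wpM2l ?mulr_ge0 ?invr_ge0 ?(ltW a0) ?(ltW b0) //.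
  rewrite [n%:R ^+ 3]exprSr ler_wpM2l ?sqr_ge0 // -[leRHS]ger0_norm // -sqrtr_sqr ler_wsqrtr //.
  by rewrite -natrX ler_nat -{1}(expn1 n) leq_exp2l.
have [xnet [h1 h2]] := lipschitz_net d0 Nr lip Cg Cxo.
exists N, xnet; split=> //.
rewrite /kl mulrCA expRM_natl lerXn2r ?nnegrE ?expR_ge0 //.
have hN : N.+1%:R <= 4 * (b / a) * n%:R ^+ 3 :> R.
  have /andP[tq _] := truncn_itv q0.
  have p1 : 1 <= n%:R ^+ 3 :> R by rewrite exprn_ege1 // ler1n (leq_trans _ n2).
  rewrite /N -!natr1; move: tq; rewrite /q; move: (n%:R ^+ 3) p1 (b / a) ratio1 => y y1 r r1.
  by nra.
apply: (le_trans hN).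
have p4 : 0 < 4 * (b / a) by rewrite mulr_gt0 // divr_gt0.
have pN : 0 < 4 * (b / a) * n%:R ^+ 3 by rewrite mulr_gt0 // exprn_gt0.
rewrite -[leLHS]lnK ?posrE // ler_expR lnM ?posrE ?exprn_gt0 //.
rewrite lnXn // -[ln n%:R *+ 3]mulr_natl /net_exponent [leRHS]mulrDl [leLHS]addrC lerD2l.
have l2 : 0 < ln 2 :> R by have := ln2_ge R; lra.
rewrite mulrAC ler_pdivlMr // ler_wpM2l // ln_ge0 //; have := ratio1; lra.
Qed.

Let noise_bad : set (fvec R I) :=
  [set v | 6 * L%:R * n%:R < \sum_l dot (noise sw l v) (noise sw l v)].

Let bad_prob : R := expR (- n%:R) + expR (- (L%:R * n%:R)) + 3 * expR (- kl).

(** The deterministic half, for a net point [x] near [xh]. Closeness and [loss xh <= loss xo] make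
    the loss at [x] nearly minimal; the likelihood event then bounds [bhatt], hence $|ADA^\top|_F$,
    and the Gram bound converts this into a bound on $|D|$. *)
Lemma recovery_of_good x v xh :
  C x -> C xh -> l2norm (xh - x) <= delta ->
  ~ opnorm_bad v -> ~ noise_bad v -> fullrank v -> ~ loss_bad sw xo x t v ->
  m%:R ^+ 2 / 6 * (\sum_j (\row_i ((xo 0 i ^+ 2 - x 0 i ^+ 2) / 2) : 'rV[R]_n) 0 j ^+ 2) -
    363 * (b ^+ 2) ^+ 2 * m%:R * n%:R * Num.sqrt t
  <= frob (Amx v *m diag_mx (\row_i ((xo 0 i ^+ 2 - x 0 i ^+ 2) / 2)) *m (Amx v)^T) ->
  loss sw xo xh v <= loss sw xo xo v ->
  n%:R^-1 * l2norm (xh - xo) ^+ 2 <= error_const a b *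
    (n%:R / m%:R ^+ 2 * (kl / L%:R) + Num.sqrt kl / m%:R).
Proof.
move=> Cx Cxh hd nop nno fr nlb hgram hmin.
set T2 := \sum_j _ in hgram.
have mR : 1 <= m%:R :> R by rewrite ler1n (leq_trans _ m2).
have mnR : m%:R <= n%:R :> R by rewrite ler_nat.
have LR : 0 < L%:R :> R by rewrite ltr0n.
have bnd y : C y -> forall i, 0 < y 0 i <= b.
  by move=> Cy i; have /andP[h1 ->] := Cab Cy i; rewrite (lt_le_trans a0 h1).
have hT2 : a ^+ 2 * l2norm (x - xo) ^+ 2 <= T2.
  rewrite l2norm_sqr mulr_sumr; apply: ler_sum => i _; rewrite !mxE.
  by apply: half_sqr_diff_ge => //; [have /andP[] := Cab Cx i|have /andP[] := Cab Cxo i].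
pose e : R := 3 / n%:R ^+ 2.
have e0 : 0 < e by rewrite divr_gt0 // exprn_gt0.
have close y z : a <= y -> a <= z -> `|y - z| <= delta -> y ^+ 2 <= (1 + e) * z ^+ 2.
  move=> ya za yz; apply: (sqr_close a0 ya za _ _ yz); first by rewrite invr_gt0 exprn_gt0.
  by rewrite invf_le1 ?exprn_gt0 // exprn_ege1 // ler1n (leq_trans _ n2).
have cl i : `|xh 0 i - x 0 i| <= delta.
  by have := le_trans (l2norm_coord (xh - x) i) hd; rewrite !mxE.
have happ := @loss_approx _ _ _ _ sw xo x xh v a b e a0 b0 e0
  (fun i => proj1 (andP (Cab Cx i))) (fun i => proj1 (andP (Cab Cxh i))).
have {}happ := happ _ fr _ _.
have hB : bhatt xo x v <= 4 * t / L%:R + approx_const a b / n%:R.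
  have h1 : loss sw xo x v <= loss sw xo xo v + approx_const a b / n%:R.
    apply: le_trans (happ _ _ _) _.
    - by move=> i; have /andP[/ltW -> ->] := bnd _ Cxo i.
    - move=> i; apply: close; [by have /andP[] := Cab Cxh i|by have /andP[] := Cab Cx i|exact: cl].
    - move=> i; apply: close; [by have /andP[] := Cab Cx i|by have /andP[] := Cab Cxh i|].
      by rewrite distrC.
    have hw : L%:R^-1 * (\sum_l dot (noise sw l v) (noise sw l v)) <= 6 * n%:R.
      by rewrite mulrC ler_pdivrMr // mulrAC leNgt; apply/negP.
    have hw2 : e * (b / a) ^+ 2 * (L%:R^-1 * (\sum_l dot (noise sw l v) (noise sw l v)))
      <= e * (b / a) ^+ 2 * (6 * n%:R) by rewrite ler_wpM2l // mulr_ge0 ?sqr_ge0 // ltW.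
    have hm : m%:R * e <= n%:R * e by rewrite ler_wpM2r // ltW.
    have -> : approx_const a b / n%:R = n%:R * e + e * (b / a) ^+ 2 * (6 * n%:R).
      by rewrite /approx_const /e; field; rewrite !gt_eqF.
    by rewrite -addrA lerD // lerD.
  have /negP : ~ (t < L%:R / 4 * (loss sw xo xo v - loss sw xo x v + bhatt xo x v)).
    by move=> h; apply: nlb.
  by rewrite -leNgt => h2; exact: le_of_scaled_le h2 h1.
have hF := bhatt_ge (leq_trans (isT : 0 < 2)%N m2) (leq_trans (isT : 0 < 2)%N n2)
  b0 (bnd _ Cx) (bnd _ Cxo) fr nop.
move: (le_trans hF hB).
rewrite ler_pdivrMr ?exprn_gt0 ?mulr_gt0 ?exprn_gt0 // mulrC => hF2.
apply: (@error_arith _ a b m%:R n%:R L%:R kl T2 (l2norm (x - xo) ^+ 2)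
  (l2norm (xh - x) ^+ 2) (l2norm (xh - xo) ^+ 2) _ a0 ab mR mnR LR _ hT2 hgram hF2) => //.
- by apply: le_trans kl_ge; rewrite lef_pV2 ?posrE // ler_nat.
- by rewrite lerXn2r // nnegrE ?sqrtr_ge0 // divr_ge0 ?sqr_ge0 // ltW.
rewrite !l2norm_sqr !mulr_sumr -big_split /=; apply: ler_sum => i _; rewrite !mxE.
exact: sqr_sub_le.
Qed.

Lemma recovery_event : exists Bad : set (fvec R I),
  [/\ measurable Bad, (mu Bad <= bad_prob%:E)%E &
    forall v, ~ Bad v -> fullrank v /\
      forall xh, C xh -> loss sw xo xh v <= loss sw xo xo v ->
      n%:R^-1 * l2norm (xh - xo) ^+ 2 <= error_const a b *
        (n%:R / m%:R ^+ 2 * (kl / L%:R) + Num.sqrt kl / m%:R)].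
Proof.
have [N [xnet [Cnet net card_net]]] := exists_net.
have m0 : (0 < m)%N by exact: leq_trans m2.
pose dv c : 'rV[R]_n := \row_i ((xo 0 i ^+ 2 - xnet c 0 i ^+ 2) / 2).
have dvb c j : `|dv c 0 j| <= b ^+ 2.
  rewrite mxE; apply: abs_half_sqr_diff_le; apply/andP; split.
  - by have /andP[h1 _] := Cab Cxo j; exact: lt_le_trans h1.
  - by have /andP[] := Cab Cxo j.
  - by have /andP[h1 _] := Cab (Cnet c) j; exact: lt_le_trans h1.
  - by have /andP[] := Cab (Cnet c) j.
have bb0 : 0 < b ^+ 2 by rewrite exprn_gt0.
have [GB GBP] := choice (fun c => gram_lower_tail muE m2 mn bb0 (dvb c) t0).
pose NB c := GB c `|` loss_bad sw xo (xnet c) t.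
have pos y : C y -> forall i, 0 < y 0 i.
  by move=> Cy i; have /andP[h1 _] := Cab Cy i; exact: lt_le_trans h1.
have LB c := loss_tail sw0 muE t L1 (pos _ (Cnet c)) (pos _ Cxo).
have mNB c : measurable (NB c).
  by apply: measurableU; [have [] := GBP c|have [] := LB c].
have NBP c : (mu (NB c) <= (3 * expR (- t))%:E)%E.
  have [g1 g2 _] := GBP c; have [l1 l2] := LB c.
  apply: (le_trans (measureU2 _ g1 l1)); apply: (le_trans (leeD g2 l2)).
  by rewrite -EFinD lee_fin (_ : _ + _ = 3 * expR (- t)) //; ring.
pose Net := [set v | exists c, NB c v].
have mNet : measurable Net by exact: measurable_exists_fin.
(* Each net point fails with probability at most $3e^{-t}$, two parts from the Gram bound and one
   from the loss. The term [net_exponent a b * kl] in [t] pays for the net and the extra [kl]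
   survives. *)
have NetP : (mu Net <= (3 * expR (- kl))%:E)%E.
  apply: (le_trans (union_bound mNB NBP)); rewrite lee_fin sumr_const card_ffun !card_ord.
  rewrite -[leLHS]mulr_natl mulrCA ler_pM2l // natrX.
  apply: (@le_trans _ _ (expR (net_exponent a b * kl) * expR (- t))).
    by rewrite ler_wpM2r ?expR_ge0.
  by rewrite -expRD (_ : _ + _ = - kl) // /t; ring.
have [mop opP] := opnorm_tail muE m0 mn.
have mno : measurable noise_bad.
  apply: (@measurable_gt_set R _ (fvec R I)
    (fun v => \sum_l dot (noise sw l v) (noise sw l v))).
  apply: measurable_sum => l.
  exact: measurable_dot (mxmeas_noise sw l) (mxmeas_noise sw l).
have noP := noise_tail sw0 muE.
pose Sing : set (fvec R I) := [set v | \det (Amx v *m (Amx v)^T) = 0].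
have mS : measurable Sing.
  apply: measurable_eq0; apply: measurable_det.
  by apply: mxmeasM; [|apply: mxmeas_tr]; exact: mxmeas_Amx.
have SP : mu Sing = 0%E.
  apply: (null_det_gram muE _ mn) => ij x; apply: gauss_set1; exact: oner_neq0.
pose OB : set (fvec R I) := @opnorm_bad R m n L.
exists (OB `|` noise_bad `|` Net `|` Sing); split.
- by apply: measurableU => //; apply: measurableU => //; exact: measurableU.
- have mU1 : measurable (OB `|` noise_bad) by exact: measurableU.
  have mU2 : measurable (OB `|` noise_bad `|` Net) by exact: measurableU.
  apply: (le_trans (measureU2 _ mU2 mS)); rewrite [X in (_ + X <= _)%E]SP adde0.
  apply: (le_trans (measureU2 _ mU1 mNet)).
  rewrite /bad_prob EFinD; apply: leeD => //.
  by apply: (le_trans (measureU2 _ mop mno)); rewrite EFinD; exact: leeD.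
move=> v nB; have nop : ~ OB v by move=> h; apply: nB; left; left; left.
have nno : ~ noise_bad v by move=> h; apply: nB; left; left; right.
have nNet : ~ Net v by move=> h; apply: nB; left; right.
have fr : fullrank v by move=> h; apply: nB; right.
split=> // xh Cxh hmin; have [c hc] := net xh Cxh.
have nNB : ~ NB c v by move=> h; apply: nNet; exists c.
apply: (recovery_of_good (Cnet c) Cxh hc nop nno fr) => //.
- by move=> h; apply: nNB; right.
- have [_ _] := GBP c; apply=> //.
  by move=> h; apply: nNB; left.
Qed.

End Recovery.

Theorem theorem1 (R : realType) (xmin xmax : R) :
  0 < xmin -> xmin <= xmax ->
  exists C1 C2 C3 : R, [/\ 0 < C1, 0 < C2 & 0 < C3] /\
  forall (m n k L : nat) (sw : R)
    (d : measure_display) (T : measurableType d) (P : probability T R)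
    (A : T -> 'M[R]_(m, n)) (W : 'I_L -> T -> 'cV[R]_n)
    (xo : 'rV[R]_n) (g : 'rV[R]_k -> 'rV[R]_n) (Cset : set 'rV[R]_n),
    (0 < m)%N -> (m < n)%N -> (1 <= L)%N -> (1 <= k)%N -> 0 < sw ->
    (* entries of A and of the w_l : mutually independent, A_ij ~ N(0,1),
       w_{l,i} ~ N(0, sw^2) *)
    mutually_independent P
      (fun ij : ('I_m * 'I_n) + ('I_L * 'I_n) =>
         match ij with
         | inl (i, j) => fun t => A t i j
         | inr (l, i) => fun t => W l t i 0
         end) ->
    (forall i j, has_normal_law P (fun t => A t i j) 0 1) ->
    (forall l i, has_normal_law P (fun t => W l t i 0) 0 sw) ->
    (forall i, xmin <= xo 0 i <= xmax) ->
    (* g is 1-Lipschitz on the ball B_k(0, xmax sqrt(n/k)) *)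
    (forall th1 th2, l2ball k (xmax * Num.sqrt (n%:R / k%:R)) th1 ->
        l2ball k (xmax * Num.sqrt (n%:R / k%:R)) th2 ->
        l2norm (g th1 - g th2) <= l2norm (th1 - th2)) ->
    Cset `<=` g @` l2ball k (xmax * Num.sqrt (n%:R / k%:R)) ->
    Cset xo ->
    (forall x, Cset x -> forall i, xmin <= x 0 i <= xmax) ->
    let y := fun t (l : 'I_L) => A t *m diag_mx xo *m W l t in
    exists E : set T, [/\ measurable E,
      (forall t, E t -> forall xhat, Cset xhat ->
         (forall x, Cset x ->
            speckle_nll sw (A t) (y t) xhat <= speckle_nll sw (A t) (y t) x) ->
         n%:R^-1 * l2norm (xhat - xo) ^+ 2 <=
         C1 * (n%:R / m%:R ^+ 2 * (k%:R * ln n%:R / L%:R)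
               + Num.sqrt (k%:R * ln n%:R) / m%:R)) &
      ((1 - C2 * (expR (- (m%:R / 2)) + expR (- (L%:R * n%:R / 8))
                  + expR (- (C3 * k%:R * ln n%:R))
                  + expR (k%:R * ln n%:R - n%:R / 2)))%:E <= P E)%E].
Proof.
(* The value 3 covers the three failures per net point and also makes the case $m=1$ trivial, since
   $3e^{-1/2}\ge 3/2$. *)
move=> a0 ab; exists (error_const xmin xmax), 3, 1.
split; first by split=> //; exact: error_const_gt0.
move=> m n k L sw d T P A W xo g C m0 mn L1 k1 sw0 [mX indep] lawA lawW _ lip Cg Cxo Cab y.
have [m1|m2] : m = 1%N \/ (2 <= m)%N by case: m m0 {mn A mX indep lawA y} => [|[|m]] // _; [left|right].
  (* For m = 1 the probability bound is vacuous. *)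
  exists set0; split=> //; rewrite measure0 lee_fin subr_le0 m1.
  have h : 2^-1 <= expR (- (1%:R / 2)) :> R.
    by apply: le_trans (expR_ge1Dx _); lra.
  have e1 := expR_ge0 (- (L%:R * n%:R / 8) : R).
  have e2 := expR_ge0 (- (1 * k%:R * ln n%:R) : R).
  have e3 := expR_ge0 (k%:R * ln n%:R - n%:R / 2 : R).
  move: (expR _) (expR _) (expR _) (expR _) h e1 e2 e3 => z1 z2 z3 z4; lra.
pose I := ('I_m * 'I_n + 'I_L * 'I_n)%type.
pose X (t : T) : fvec R I := fun ij =>
  match ij with inl (i, j) => A t i j | inr (l, i) => W l t i 0 end.
have mXf : measurable_fun setT X.
  by apply: measurable_to_fvec => -[[i j]|[l i]]; [exact: (mX (inl (i, j)))|exact: (mX (inr (l, i)))].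
pose Xm : {mfun T >-> fvec R I} := HB.pack X (isMeasurableFun.Build _ _ _ _ X mXf).
(* The joint law of [A] and the speckle, carried to the product space; independence and the
   marginals give exactly the product formula on rectangles. *)
pose mu : probability (fvec R I) R := distribution P Xm.
have muE (B : I -> set R) : (forall i, measurable (B i)) ->
    mu [set v | forall i, B i (v i)] = (\prod_i model_law sw i (B i))%E.
  move=> mB; have := indep B mB.
  set L1' := P _; set R1 := (\prod_(i : I) _)%E; move=> E.
  transitivity L1'.
    rewrite /mu /distribution /pushforward /L1'; congr (P _).
    apply/seteqP; split=> t /= h.
      by move=> [[i j]|[l i]] _ /=; [exact: (h (inl (i, j)))|exact: (h (inr (l, i)))].
    by move=> [[i j]|[l i]] /=; [exact: (h (inl (i, j)))|exact: (h (inr (l, i)))].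
  rewrite E; apply: eq_bigr => -[[i j]|[l i]] _ /=.
    exact: lawA.
  exact: lawW.
have [Bad [mBad PBad good]] :=
  recovery_event muE m2 (ltnW mn) L1 k1 sw0 a0 ab lip Cg Cxo Cab.
exists (X @^-1` (~` Bad)); split.
- by rewrite -[X in measurable X]setTI; exact: (mXf measurableT _ (measurableC mBad)).
- move=> t nB xh Cxh hmin; have [fr rec] := good (X t) nB.
  have EA : Amx (X t) = A t by apply/matrixP => i j; rewrite mxE.
  have Ey : y t = fun l => Amx (X t) *m diag_mx xo *m \col_i X t (inr (l, i)).
    apply/funext => l; rewrite EA; congr (_ *m _).
    by apply/colP => i; rewrite mxE.
  (* Minimality is used against the single competitor [xo], so the event serves all minimisers at
     once. *)
  apply: (rec xh Cxh); have := hmin xo Cxo; rewrite -EA Ey.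
  have pos x : C x -> forall i, 0 < x 0 i.
    by move=> Cx i; have /andP[h _] := Cab x Cx i; exact: lt_le_trans h.
  by rewrite !speckle_nllE ?lerD2l //; exact: pos.
have -> : P (X @^-1` (~` Bad)) = (1 - mu Bad)%E.
  by rewrite preimage_setC probability_setC // -[X in measurable X]setTI; exact: (mXf measurableT _ mBad).
rewrite EFinB leeB //; apply: le_trans PBad _; rewrite lee_fin.
have h1 : expR (- n%:R) <= expR (- (m%:R / 2)) :> R.
  rewrite ler_expR lerN2; have : m%:R <= n%:R :> R by rewrite ler_nat ltnW.
  by have : 0 <= m%:R :> R by []; lra.
have h2 : expR (- (L%:R * n%:R)) <= expR (- (L%:R * n%:R / 8)) :> R.
  rewrite ler_expR lerN2; have : 0 <= L%:R * n%:R :> R by rewrite mulr_ge0.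
  by lra.
have e1 := expR_ge0 (- (L%:R * n%:R / 8) : R).
have e2 := expR_ge0 (k%:R * ln n%:R - n%:R / 2 : R).
have e3 := expR_ge0 (- (m%:R / 2) : R).
rewrite mul1r.
move: h1 h2 e1 e2 e3; move: (expR _) (expR _) (expR _) (expR _) (expR _) (expR _).
move=> z1 z2 z3 z4 z5 z6; lra.
Qed.
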